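(* Let $k>1$ and let $U\in Z$, where $Z$ is the $9$-dimensional manifold of spherical solutions described in the context. If $\varphi\in \mathcal C^2(\mathbb S^2,\mathbb R^3)$ solves the linear system $$\Delta \varphi-2U_3^{-1}G'(\nabla U)\nabla\varphi=-U_3^{-1}\varphi_3\,\Delta U+2U_3^{-1}k\big(\partial_x\varphi\wedge\partial_yU+\partial_xU\wedge\partial_y\varphi\big)\quad\text{on }\mathbb R^2,$$ then $\varphi\in T_UZ$.
   Context: $\{e_1,e_2,e_3\}$ is the canonical basis of $\mathbb R^3$, $\wedge$ is the exterior (cross) product in $\mathbb R^3$. The hyperbolic space $\mathbb H^3$ is the upper half-space $\mathbb R^3_+=\{p_3>0\}$ with metric $p_3^{-2}\delta_{hj}$. The sphere $\mathbb S^2$ is identified with $\mathbb R^2\cup\{\infty\}$ by stereographic projection from the north pole, and $z=(x,y)\in\mathbb R^2$ is identified with $x+iy\in\mathbb C$. Thus $\mathcal C^2(\mathbb S^2,\mathbb R^3)$ is the space of $u\in\mathcal C^2(\mathbb R^2,\mathbb R^3)$ such that $z\mapsto u(z^{-1})$ (extended at $0$) is also in $\mathcal C^2(\mathbb R^2,\mathbb R^3)$; $\Delta,\nabla,\partial_x,\partial_y$ are the flat operators on $\mathbb R^2$. For maps $u$ set $G_\ell(\nabla u)=\nabla u_3\cdot\nabla u_\ell-\frac12|\nabla u|^2\delta_{\ell3}$, $\ell=1,2,3$, and $G'(\nabla U)\nabla\varphi$ is its differential: $(G'(\nabla U)\nabla\varphi)_\ell=\nabla U_3\cdot\nabla\varphi_\ell+\nabla\varphi_3\cdot\nabla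 U_\ell-(\nabla U\cdot\nabla\varphi)\,\delta_{\ell3}$, where $\nabla U\cdot\nabla\varphi=\partial_xU\cdot\partial_x\varphi+\partial_yU\cdot\partial_y\varphi$. (The linear system is the linearization at $U$ of $\Delta u-2u_3^{-1}G(\nabla u)=2u_3^{-1}k\,\partial_xu\wedge\partial_yu$, which every $U\in Z$ solves.) Let $\mu(z)=\frac{2}{1+|z|^2}$, $\omega(x,y)=(\mu x,\mu y,1-\mu)$, $r_k=\frac1{\sqrt{k^2-1}}$, $\mathsf U=r_k(\omega+ke_3)$, and for $q\in\mathbb H^3$ let $\mathsf U_q=q_3\mathsf U+q_1e_1+q_2e_2$. Let $PGL(2,\mathbb C)$ denote the group of Möbius transformations of $\mathbb R^2\cup\{\infty\}\equiv\mathbb C\cup\{\infty\}$. Then $$Z=\{\mathsf U_q\circ g\ |\ g\in PGL(2,\mathbb C),\ q\in\mathbb H^3\}.$$ $T_UZ$ is the tangent space to $Z$ at $U$. Explicitly, $T_UZ$ is the real span of $e_1,e_2,U$ and of $z^h\nabla U,\ iz^h\nabla U$, $h=0,1,2$, where for $\tau=(\tau_1,\tau_2)\in\mathbb R^2$ one sets $\tau\nabla U=\tau_1\partial_xU+\tau_2\partial_yU$ (and $z^h$, $iz^h$ are regarded as vectors in $\mathbb R^2$). At $U=\mathsf U$ this is $\{s-(s\cdot\omega)\omega+t\wedge\omega\,|\,s,t\in\mathbb R^3\}\oplus\{(\alpha\cdot(k\omega+e_3))\,\omega\,|\,\alpha\in\mathbb R^3\}$, and $T_{\mathsf U_q\circ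 g}Z=\{\tau\circ g\,|\,\tau\in T_{\mathsf U}Z\}$. *)

(* Defs.v *)
From Stdlib Require Import Reals List.
From Coquelicot Require Import Coquelicot.
Import ListNotations.
Local Open Scope R_scope.

(* The vector operations [plus], [minus], [scal], [zero] on [R3] are those of
   the product structure of Coquelicot's hierarchy. *)
Definition R3 : Type := (R * R * R)%type.

Definition p1 (v : R3) : R := fst (fst v).
Definition p2 (v : R3) : R := snd (fst v).
Definition p3 (v : R3) : R := snd v.

Definition e1 : R3 := (1, 0, 0).
Definition e2 : R3 := (0, 1, 0).
Definition e3 : R3 := (0, 0, 1).

Definition dot (u v : R3) : R := p1 u * p1 v + p2 u * p2 v + p3 u * p3 v.

Definition cross (u v : R3) : R3 :=
  (p2 u * p3 v - p3 u * p2 v,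
   p3 u * p1 v - p1 u * p3 v,
   p1 u * p2 v - p2 u * p1 v).

(* Maps on the plane have domain [C], which is literally [R * R]. *)
Definition curried (p : R3 -> R) (u : C -> R3) : R -> R -> R :=
  fun x y => p (u (x, y)).

Definition partial3 (m n : nat) (u : C -> R3) (z : C) : R3 :=
  (partial_derive m n (curried p1 u) (fst z) (snd z),
   partial_derive m n (curried p2 u) (fst z) (snd z),
   partial_derive m n (curried p3 u) (fst z) (snd z)).

Definition Dx : (C -> R3) -> C -> R3 := partial3 1 0.
Definition Dy : (C -> R3) -> C -> R3 := partial3 0 1.

Definition Laplacian (u : C -> R3) (z : C) : R3 :=
  plus (partial3 2 0 u z) (partial3 0 2 u z).

Definition C2_plane (u : C -> R3) : Prop :=
  forall x y : R,
    ex_diff_n (curried p1 u) 2 x y /\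
    ex_diff_n (curried p2 u) 2 x y /\
    ex_diff_n (curried p3 u) 2 x y.

(* [v] is the extension to the origin of [z |-> u (z^{-1})]; the inverse is the
   complex one. *)
Definition C2_sphere (u : C -> R3) : Prop :=
  C2_plane u /\
  exists v : C -> R3,
    C2_plane v /\ forall z : C, z <> RtoC 0 -> v z = u (Cinv z).

Definition grad_dot (u v : C -> R3) (z : C) : R :=
  dot (Dx u z) (Dx v z) + dot (Dy u z) (Dy v z).

Definition grad_dot_comp (p q : R3 -> R) (u v : C -> R3) (z : C) : R :=
  p (Dx u z) * q (Dx v z) + p (Dy u z) * q (Dy v z).

Definition dG (U phi : C -> R3) (z : C) : R3 :=
  let sym (p : R3 -> R) :=
    grad_dot_comp p3 p U phi z + grad_dot_comp p3 p phi U z in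
  (sym p1, sym p2, sym p3 - grad_dot U phi z).

Definition linearized_system (k : R) (U phi : C -> R3) : Prop :=
  forall z : C,
    minus (Laplacian phi z) (scal (2 * / p3 (U z)) (dG U phi z)) =
    plus (scal (- (/ p3 (U z) * p3 (phi z))) (Laplacian U z))
         (scal (2 * / p3 (U z) * k)
            (plus (cross (Dx phi z) (Dy U z)) (cross (Dx U z) (Dy phi z)))).

(* The Riemann sphere: [None] is the point at infinity. *)
Definition Csphere : Type := option C.

Definition moebius (a b c d : C) (w : Csphere) : Csphere :=
  match w with
  | Some z =>
      if Ceq_dec (c * z + d)%C (RtoC 0) then None
      else Some ((a * z + b) / (c * z + d))%C
  | None => if Ceq_dec c (RtoC 0) then None else Some (a / c)%C
  end.

Definition PGL2 (g : Csphere -> Csphere) : Prop :=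
  exists a b c d : C,
    (a * d - b * c)%C <> RtoC 0 /\ forall w, g w = moebius a b c d w.

Definition mu (z : C) : R := 2 / (1 + (fst z ^ 2 + snd z ^ 2)).

(* At infinity [omega] takes its limit value, the north pole. *)
Definition omega (w : Csphere) : R3 :=
  match w with
  | Some z => (mu z * fst z, mu z * snd z, 1 - mu z)
  | None => e3
  end.

Definition r_ (k : R) : R := 1 / sqrt (k ^ 2 - 1).

Definition Usf (k : R) (w : Csphere) : R3 :=
  scal (r_ k) (plus (omega w) (scal k e3)).

Definition hyperbolic_space (q : R3) : Prop := 0 < p3 q.

Definition Usf_at (k : R) (q : R3) (w : Csphere) : R3 :=
  plus (plus (scal (p3 q) (Usf k w)) (scal (p1 q) e1)) (scal (p2 q) e2).

Definition Z_manifold (k : R) (U : C -> R3) : Prop :=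
  exists (q : R3) (g : Csphere -> Csphere),
    hyperbolic_space q /\ PGL2 g /\ forall z : C, U z = Usf_at k q (g (Some z)).

Fixpoint real_span (vs : list (C -> R3)) (f : C -> R3) : Prop :=
  match vs with
  | [] => forall z, f z = zero
  | v :: vs' =>
      exists a : R, real_span vs' (fun z => minus (f z) (scal a (v z)))
  end.

(* The field [tau nabla U], where the complex number [tau z] is read as a
   vector of the plane. *)
Definition along (tau : C -> C) (U : C -> R3) (z : C) : R3 :=
  plus (scal (fst (tau z)) (Dx U z)) (scal (snd (tau z)) (Dy U z)).

Definition tangent_space (U : C -> R3) : (C -> R3) -> Prop :=
  real_span
    ([fun _ => e1; fun _ => e2; U]
     ++ map (fun h : nat => along (fun z => (z ^ h)%C) U) [0; 1; 2]%nat
     ++ map (fun h : nat => along (fun z => (Ci * z ^ h)%C) U) [0; 1; 2]%nat).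

(* Main.v *)
Require Import Defs.
From Stdlib Require Import Reals.
From Coquelicot Require Import Coquelicot.
From Stdlib Require Import Lra Psatz List.
Local Open Scope R_scope.

(** A bubble is U = q + r n, where n is a conformal map onto the unit sphere and
    the third coordinate of U is r (n3 + k).  Write n for the unit normal,
    rho = |n_x|^2 = |n_y|^2 for the conformal factor, and split a solution phi of
    the linearised system into its normal part (phi . n) n and its tangential part
    X . grad n, with X = (phi . n_x, phi . n_y) / rho.  Scalar products of the
    system with n_x, n_y and n decouple the two parts.

    Tangential part.  The products with n_x and n_y say that the linearised Hopf
    differential, with coefficients phi_x . n_x - phi_y . n_y and
    phi_x . n_y + phi_y . n_x, becomes holomorphic after division by (n3 + k)^2
    ([weighted_liouville], [hopf_vanishes]).  A quadratic differential on the sphere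
    decays like |z|^(-4) at infinity, so it vanishes: phi is infinitesimally
    conformal.  Then X is a holomorphic vector field on the sphere, hence a complex
    polynomial of degree at most 2 ([hopf_free_quadratic]).

    Normal part.  The product with n is an equation for f = phi . n alone.  In terms of
    psi = f / (n3 + k) it is the Jacobi equation Lap psi + 2 rho' psi = 0, where
    rho' = (k^2 - 1) rho / (n3 + k)^2 is, up to a constant factor, the metric induced
    by hyperbolic space; rho' is the conformal factor of another conformal map n'
    onto the unit sphere, obtained by following the Moebius map with a dilation.  So
    psi is a first spherical harmonic, a . n' ([jacobi_linear]).  The regularity is
    the delicate point, since psi is only C^2: instead of differentiating the Hessian
    of psi one looks at the map
    Y = psi n' + (psi_x n'_x + psi_y n'_y) / rho', of class C^1 only.  The Jacobi
    equation turns into Y_x = - n' /\ Y_y and Y_y = n' /\ Y_x, so Y is weakly harmonic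
    (it would parametrise a closed minimal surface with Gauss map n'); therefore Y is a
    constant a, and psi = Y . n'.

    Both parts rest on one Liouville theorem, [harmonic_liouville], for C^1 functions
    with a limit at infinity whose conjugate differential is an exact form plus a closed
    C^1 form; its proof is the mean value property over circles.  Behaviour at
    infinity is read in the coordinate w = 1/z, where only first derivatives have
    to be transformed.

    Finally n1 n, n2 n and n3 n differ from the constant fields e1, e2, e3 by
    tangential fields, which are again infinitesimally conformal and hence again
    quadratic; this puts phi in the span of e1, e2, U and the fields z^h grad U,
    i z^h grad U. *)

(** * Continuously differentiable functions of two variables *)

(** Both first derivatives are named, so that identities between derivatives of
    explicit functions become ring or field identities. *)
Definition is_C1 (f fx fy : R -> R -> R) : Prop :=
  (forall x y, is_derive (fun t => f t y) x (fx x y)) /\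
  (forall x y, is_derive (fun t => f x t) y (fy x y)) /\
  (forall x y, continuity_2d_pt fx x y) /\
  (forall x y, continuity_2d_pt fy x y).

Lemma is_C1_differentiable f fx fy x y :
  is_C1 f fx fy -> differentiable_pt_lim f x y (fx x y) (fy x y).
Proof.
  intros (Hx & Hy & Cx & _). apply filterdiff_differentiable_pt_lim.
  apply is_derive_filterdiff with (dfx := fx).
  - apply filter_forall. intros u. apply Hx.
  - apply Hy.
  - apply continuity_2d_pt_filterlim. apply Cx.
Qed.

Lemma is_C1_continuity f fx fy x y : is_C1 f fx fy -> continuity_2d_pt f x y.
Proof.
  intros H. apply differentiable_continuity_pt.
  exists (fx x y), (fy x y). now apply is_C1_differentiable.
Qed.

Lemma is_C1_ext f g fx fy gx gy :
  is_C1 f fx fy ->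
  (forall x y, f x y = g x y) -> (forall x y, fx x y = gx x y) ->
  (forall x y, fy x y = gy x y) -> is_C1 g gx gy.
Proof.
  intros (Hx & Hy & Cx & Cy) E Ex Ey. split; [|split; [|split]]; intros x y.
  - rewrite <- Ex. apply is_derive_ext with (fun t => f t y); auto.
  - rewrite <- Ey. apply is_derive_ext with (fun t => f x t); auto.
  - apply continuity_2d_pt_ext with fx; auto.
  - apply continuity_2d_pt_ext with fy; auto.
Qed.

Lemma is_C1_eq f fx fy gx gy :
  is_C1 f fx fy -> (forall x y, fx x y = gx x y) ->
  (forall x y, fy x y = gy x y) -> is_C1 f gx gy.
Proof. intros F. apply is_C1_ext with (1 := F). reflexivity. Qed.

Lemma is_C1_unique f fx fy gx gy x y :
  is_C1 f fx fy -> is_C1 f gx gy -> fx x y = gx x y /\ fy x y = gy x y.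
Proof.
  intros (Hx & Hy & _) (Gx & Gy & _). split.
  - transitivity (Derive (fun t => f t y) x).
    symmetry. now apply is_derive_unique. now apply is_derive_unique.
  - transitivity (Derive (fun t => f x t) y).
    symmetry. now apply is_derive_unique. now apply is_derive_unique.
Qed.

Lemma is_C1_const c : is_C1 (fun _ _ => c) (fun _ _ => 0) (fun _ _ => 0).
Proof.
  split; [|split; [|split]]; intros x y; try apply continuity_2d_pt_const;
    apply (is_derive_const c).
Qed.

Lemma is_C1_plus f fx fy g gx gy :
  is_C1 f fx fy -> is_C1 g gx gy ->
  is_C1 (fun x y => f x y + g x y) (fun x y => fx x y + gx x y)
    (fun x y => fy x y + gy x y).
Proof.
  intros (F1 & F2 & F3 & F4) (G1 & G2 & G3 & G4); split; [|split; [|split]]; intros x y.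
  - apply (is_derive_plus (fun t => f t y) (fun t => g t y)); auto.
  - apply (is_derive_plus (fun t => f x t) (fun t => g x t)); auto.
  - apply continuity_2d_pt_plus; auto.
  - apply continuity_2d_pt_plus; auto.
Qed.

Lemma is_C1_mult f fx fy g gx gy :
  is_C1 f fx fy -> is_C1 g gx gy ->
  is_C1 (fun x y => f x y * g x y)
    (fun x y => fx x y * g x y + f x y * gx x y)
    (fun x y => fy x y * g x y + f x y * gy x y).
Proof.
  intros F G. generalize F G.
  intros (F1 & F2 & F3 & F4) (G1 & G2 & G3 & G4); split; [|split; [|split]]; intros x y.
  - apply (is_derive_mult (fun t => f t y) (fun t => g t y)); auto. intros; apply Rmult_comm.
  - apply (is_derive_mult (fun t => f x t) (fun t => g x t)); auto. intros; apply Rmult_comm.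
  - apply continuity_2d_pt_plus; apply continuity_2d_pt_mult; eauto using is_C1_continuity.
  - apply continuity_2d_pt_plus; apply continuity_2d_pt_mult; eauto using is_C1_continuity.
Qed.

Lemma is_C1_opp f fx fy :
  is_C1 f fx fy ->
  is_C1 (fun x y => - f x y) (fun x y => - fx x y) (fun x y => - fy x y).
Proof.
  intros (F1 & F2 & F3 & F4); split; [|split; [|split]]; intros x y.
  - apply (is_derive_opp (fun t => f t y)); auto.
  - apply (is_derive_opp (fun t => f x t)); auto.
  - apply continuity_2d_pt_opp; auto.
  - apply continuity_2d_pt_opp; auto.
Qed.

Lemma is_C1_minus f fx fy g gx gy :
  is_C1 f fx fy -> is_C1 g gx gy ->
  is_C1 (fun x y => f x y - g x y) (fun x y => fx x y - gx x y)
    (fun x y => fy x y - gy x y).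
Proof. intros F G. exact (is_C1_plus _ _ _ _ _ _ F (is_C1_opp _ _ _ G)). Qed.

Lemma is_C1_inv f fx fy :
  is_C1 f fx fy -> (forall x y, f x y <> 0) ->
  is_C1 (fun x y => / f x y) (fun x y => - fx x y / f x y ^ 2)
    (fun x y => - fy x y / f x y ^ 2).
Proof.
  intros F N. generalize F. intros (F1 & F2 & F3 & F4); split; [|split; [|split]]; intros x y.
  - apply (is_derive_inv (fun t => f t y)); auto.
  - apply (is_derive_inv (fun t => f x t)); auto.
  - apply continuity_2d_pt_mult. now apply continuity_2d_pt_opp.
    apply continuity_2d_pt_inv. 2: now apply pow_nonzero.
    simpl. repeat apply continuity_2d_pt_mult; eauto using is_C1_continuity, continuity_2d_pt_const.
  - apply continuity_2d_pt_mult. now apply continuity_2d_pt_opp.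
    apply continuity_2d_pt_inv. 2: now apply pow_nonzero.
    simpl. repeat apply continuity_2d_pt_mult; eauto using is_C1_continuity, continuity_2d_pt_const.
Qed.

Lemma is_C1_div f fx fy g gx gy :
  is_C1 f fx fy -> is_C1 g gx gy -> (forall x y, g x y <> 0) ->
  is_C1 (fun x y => f x y / g x y)
    (fun x y => (fx x y * g x y - f x y * gx x y) / g x y ^ 2)
    (fun x y => (fy x y * g x y - f x y * gy x y) / g x y ^ 2).
Proof.
  intros F G N. eapply is_C1_ext.
  - apply is_C1_mult. exact F. apply is_C1_inv. exact G. exact N.
  - reflexivity.
  - intros; simpl; field; auto.
  - intros; simpl; field; auto.
Qed.

Lemma is_C1_sqr f fx fy :
  is_C1 f fx fy ->
  is_C1 (fun x y => f x y ^ 2) (fun x y => 2 * f x y * fx x y) (fun x y => 2 * f x y * fy x y).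
Proof.
  intros F. eapply is_C1_ext.
  - exact (is_C1_mult _ _ _ _ _ _ F F).
  - intros; simpl; ring.
  - intros; simpl; ring.
  - intros; simpl; ring.
Qed.

Lemma is_C1_fst g g' :
  (forall x, is_derive g x (g' x)) -> (forall x, continuous g' x) ->
  is_C1 (fun x _ => g x) (fun x _ => g' x) (fun _ _ => 0).
Proof.
  intros D C; split; [|split; [|split]]; intros x y.
  - apply D.
  - apply (is_derive_const (g x)).
  - apply continuity_1d_2d_pt_comp with (f := g') (g := fun u _ => u).
    apply continuity_pt_filterlim, C. apply continuity_2d_pt_id1.
  - apply continuity_2d_pt_const.
Qed.

Lemma is_C1_snd g g' :
  (forall y, is_derive g y (g' y)) -> (forall y, continuous g' y) ->
  is_C1 (fun _ y => g y) (fun _ _ => 0) (fun _ y => g' y).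
Proof.
  intros D C; split; [|split; [|split]]; intros x y.
  - apply (is_derive_const (g y)).
  - apply D.
  - apply continuity_2d_pt_const.
  - apply continuity_1d_2d_pt_comp with (f := g') (g := fun _ v => v).
    apply continuity_pt_filterlim, C. apply continuity_2d_pt_id2.
Qed.

Lemma is_C1_x : is_C1 (fun x _ => x) (fun _ _ => 1) (fun _ _ => 0).
Proof.
  apply (is_C1_fst (fun x => x) (fun _ => 1)); intros.
  - apply (is_derive_id x).
  - apply continuous_const.
Qed.

Lemma is_C1_y : is_C1 (fun _ y => y) (fun _ _ => 0) (fun _ _ => 1).
Proof.
  apply (is_C1_snd (fun x => x) (fun _ => 1)); intros.
  - apply (is_derive_id y).
  - apply continuous_const.
Qed.

(** Differentiates an expression built from known C^1 functions; the derivatives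
    are left to unification, and the non-vanishing of denominators to the caller. *)
Ltac C1_solve :=
  repeat first [ eassumption | match goal with
  | |- is_C1 (fun x y => @?f x y + @?g x y) _ _ => eapply (is_C1_plus f _ _ g)
  | |- is_C1 (fun x y => @?f x y - @?g x y) _ _ => eapply (is_C1_minus f _ _ g)
  | |- is_C1 (fun x y => @?f x y * @?g x y) _ _ => eapply (is_C1_mult f _ _ g)
  | |- is_C1 (fun x y => @?f x y / @?g x y) _ _ => eapply (is_C1_div f _ _ g)
  | |- is_C1 (fun x y => - @?f x y) _ _ => eapply (is_C1_opp f)
  | |- is_C1 (fun x y => @?f x y ^ 2) _ _ => eapply (is_C1_sqr f)
  | |- is_C1 (fun _ _ => ?c) _ _ => eapply (is_C1_const c)
  end ].

Lemma continuity_2d_pt_comp f u v x y :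
  continuity_2d_pt f (u x y) (v x y) ->
  continuity_2d_pt u x y -> continuity_2d_pt v x y ->
  continuity_2d_pt (fun x y => f (u x y) (v x y)) x y.
Proof.
  intros F U V eps. destruct (F eps) as [d Hd].
  destruct (U d) as [d1 H1], (V d) as [d2 H2].
  exists (mkposreal _ (Rmin_stable_in_posreal d1 d2)). simpl. intros a b Ha Hb.
  apply Hd.
  - apply H1; eapply Rlt_le_trans; eauto using Rmin_l.
  - apply H2; eapply Rlt_le_trans; eauto using Rmin_r.
Qed.

Lemma is_C1_comp f fx fy u ux uy v vx vy :
  is_C1 f fx fy -> is_C1 u ux uy -> is_C1 v vx vy ->
  is_C1 (fun x y => f (u x y) (v x y))
    (fun x y => fx (u x y) (v x y) * ux x y + fy (u x y) (v x y) * vx x y)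
    (fun x y => fx (u x y) (v x y) * uy x y + fy (u x y) (v x y) * vy x y).
Proof.
  intros F U V. generalize F U V.
  intros (F1 & F2 & F3 & F4) (U1 & U2 & U3 & U4) (V1 & V2 & V3 & V4).
  split; [|split; [|split]]; intros x y.
  - apply is_derive_Reals.
    apply (derivable_pt_lim_comp_2d f (fun t => u t y) (fun t => v t y)).
    now apply is_C1_differentiable. now apply is_derive_Reals. now apply is_derive_Reals.
  - apply is_derive_Reals.
    apply (derivable_pt_lim_comp_2d f (fun t => u x t) (fun t => v x t)).
    now apply is_C1_differentiable. now apply is_derive_Reals. now apply is_derive_Reals.
  - apply continuity_2d_pt_plus; apply continuity_2d_pt_mult; auto;
      apply continuity_2d_pt_comp; eauto using is_C1_continuity.
  - apply continuity_2d_pt_plus; apply continuity_2d_pt_mult; auto;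
      apply continuity_2d_pt_comp; eauto using is_C1_continuity.
Qed.

Lemma is_C1_schwarz f fx fy fxx fxy fyx fyy x y :
  is_C1 f fx fy -> is_C1 fx fxx fxy -> is_C1 fy fyx fyy -> fyx x y = fxy x y.
Proof.
  intros (F1 & F2 & _) (X1 & X2 & X3 & X4) (Y1 & Y2 & Y3 & Y4).
  assert (Ex : forall x y, Derive (fun t => f t y) x = fx x y)
    by (intros; now apply is_derive_unique).
  assert (Ey : forall x y, Derive (fun t => f x t) y = fy x y)
    by (intros; now apply is_derive_unique).
  assert (DX : forall x y, is_derive (fun z => Derive (fun t => f t z) x) y (fxy x y)).
  { intros a b. apply is_derive_ext with (fun z => fx a z); [|apply X2].
    intros; now rewrite Ex. }
  assert (DY : forall x y, is_derive (fun z => Derive (fun t => f z t) y) x (fyx x y)).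
  { intros a b. apply is_derive_ext with (fun z => fy z b); [|apply Y1].
    intros; now rewrite Ey. }
  rewrite <- (is_derive_unique _ _ _ (DX x y)), <- (is_derive_unique _ _ _ (DY x y)).
  apply Schwarz.
  - apply locally_2d_forall. intros u v. repeat split.
    + exists (fx u v). apply F1.
    + exists (fy u v). apply F2.
    + exists (fyx u v). apply DY.
    + exists (fxy u v). apply DX.
  - apply continuity_2d_pt_ext with fyx; [|apply Y3].
    intros; symmetry; apply is_derive_unique, DY.
  - apply continuity_2d_pt_ext with fxy; [|apply X4].
    intros; symmetry; apply is_derive_unique, DX.
Qed.

Lemma is_C1_zero_gradient f fx fy :
  is_C1 f fx fy -> (forall x y, fx x y = 0) -> (forall x y, fy x y = 0) ->
  forall x y, f x y = f 0 0.
Proof.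
  intros (F1 & F2 & _) Zx Zy x y. transitivity (f 0 y).
  - destruct (MVT_gen (fun t => f t y) 0 x (fun t => fx t y)) as (c & _ & Hc).
    + intros; apply F1.
    + intros. apply continuity_pt_filterlim.
      apply (ex_derive_continuous (fun t => f t y)). eexists; apply F1.
    + rewrite Zx in Hc. lra.
  - destruct (MVT_gen (fun t => f 0 t) 0 y (fun t => fy 0 t)) as (c & _ & Hc).
    + intros; apply F2.
    + intros. apply continuity_pt_filterlim.
      apply (ex_derive_continuous (fun t => f 0 t)). eexists; apply F2.
    + rewrite Zy in Hc. lra.
Qed.

Lemma continuity_2d_pt_origin g c :
  continuity_2d_pt g 0 0 -> (forall x y, x ^ 2 + y ^ 2 <> 0 -> g x y = c) -> g 0 0 = c.
Proof.
  intros C Z. apply cond_eq. intros eps He. destruct (C (mkposreal eps He)) as [d Hd].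
  simpl in Hd. assert (P := cond_pos d).
  rewrite <- (Z (d / 2) 0), Rabs_minus_sym.
  - apply Hd; rewrite Rminus_0_r.
    + rewrite Rabs_pos_eq; lra.
    + rewrite Rabs_R0; lra.
  - rewrite pow_ne_zero by discriminate. assert (0 < (d / 2) ^ 2) by (apply pow_lt; lra). lra.
Qed.

Lemma is_C1_quotient_C2 f fx fy fxx fxy fyy u ux uy uxx uxy uyy :
  is_C1 f fx fy -> is_C1 fx fxx fxy -> is_C1 fy fxy fyy ->
  is_C1 u ux uy -> is_C1 ux uxx uxy -> is_C1 uy uxy uyy ->
  (forall x y, u x y <> 0) ->
  let sx x y := (fx x y * u x y - f x y * ux x y) / u x y ^ 2 in
  let sy x y := (fy x y * u x y - f x y * uy x y) / u x y ^ 2 in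
  let second fab fa fb uab ua ub x y :=
    (fab x y * u x y ^ 2 - (fa x y * ub x y + fb x y * ua x y + f x y * uab x y) * u x y
     + 2 * f x y * ua x y * ub x y) / u x y ^ 3 in
  is_C1 (fun x y => f x y / u x y) sx sy /\
  is_C1 sx (second fxx fx fx uxx ux ux) (second fxy fx fy uxy ux uy) /\
  is_C1 sy (second fxy fx fy uxy ux uy) (second fyy fy fy uyy uy uy).
Proof.
  intros F FX FY U UX UY N sx sy second.
  assert (N2 : forall x y, u x y ^ 2 <> 0) by (intros; now apply pow_nonzero).
  split; [|split].
  - now apply is_C1_div.
  - eapply is_C1_eq; [unfold sx; C1_solve; exact N2 | |];
      intros x y; unfold second; field; apply N.
  - eapply is_C1_eq; [unfold sy; C1_solve; exact N2 | |];
      intros x y; unfold second; field; apply N.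
Qed.

(** * Means over circles and a Liouville theorem *)

Lemma continuity_2d_pt_snd f x y :
  continuity_2d_pt f x y -> continuous (fun t => f x t) y.
Proof.
  intros C. apply continuity_pt_filterlim. intros eps He.
  destruct (C (mkposreal eps He)) as [d Hd]. exists d. split. apply d.
  intros t [_ Ht]. apply Hd. rewrite Rminus_diag, Rabs_R0. apply d. exact Ht.
Qed.

Lemma ex_RInt_of_continuity_2d g r a b :
  (forall t, continuity_2d_pt g r t) -> ex_RInt (fun t => g r t) a b.
Proof.
  intros C. apply (@ex_RInt_continuous R_CompleteNormedModule). intros t _.
  now apply continuity_2d_pt_snd.
Qed.

Definition turn_integral (g : R -> R) : R := RInt g 0 (2 * PI).

Lemma turn_integral_ext f g :
  (forall t, f t = g t) -> turn_integral f = turn_integral g.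
Proof. intros E. apply RInt_ext. intros; apply E. Qed.

Lemma turn_integral_const c : turn_integral (fun _ => c) = 2 * PI * c.
Proof.
  unfold turn_integral. rewrite RInt_const. unfold scal; simpl. unfold mult; simpl. f_equal. ring.
Qed.

Lemma turn_integral_combination r f g h :
  ex_RInt f 0 (2 * PI) -> ex_RInt g 0 (2 * PI) -> ex_RInt h 0 (2 * PI) ->
  (forall t, r * f t = g t + h t) ->
  r * turn_integral f = turn_integral g + turn_integral h.
Proof.
  intros F G H E. symmetry. etransitivity.
  - symmetry. apply (RInt_plus (V := R_CompleteNormedModule)); assumption.
  - etransitivity; [|apply (RInt_scal (V := R_CompleteNormedModule)); exact F].
    apply RInt_ext. intros t _. symmetry. apply E.
Qed.

Lemma turn_integral_derivative k kr kt r :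
  is_C1 k kr kt -> k r (2 * PI) = k r 0 -> turn_integral (fun t => kt r t) = 0.
Proof.
  intros (K1 & K2 & K3 & K4) P. apply is_RInt_unique.
  replace 0 with (minus (k r (2 * PI)) (k r 0)) at 2.
  - apply (is_RInt_derive (fun t => k r t)).
    + intros; apply K2.
    + intros; now apply continuity_2d_pt_snd.
  - rewrite P. apply (minus_eq_zero (k r 0)).
Qed.

(** Differentiation under the integral sign: a circle mean is independent of the
    radius as soon as the integrals of the radial derivative vanish. *)
Lemma turn_integral_radius g gr gt r :
  is_C1 g gr gt -> (forall r, turn_integral (fun t => gr r t) = 0) ->
  turn_integral (fun t => g r t) = turn_integral (fun t => g 0 t).
Proof.
  intros G Z. generalize G. intros (G1 & G2 & G3 & G4).
  assert (E : forall r t, Derive (fun z => g z t) r = gr r t)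
    by (intros; now apply is_derive_unique).
  assert (D : forall r, is_derive (fun r => turn_integral (fun t => g r t)) r 0).
  { intros s.
    assert (Es : turn_integral (fun t => Derive (fun z => g z t) s) = 0).
    { transitivity (turn_integral (fun t => gr s t)); [|apply Z].
      apply turn_integral_ext. intros; apply E. }
    refine (eq_rect _ (is_derive _ s) _ _ Es).
    apply is_derive_RInt_param.
    - apply filter_forall. intros u t _. exists (gr u t). apply G1.
    - intros t _. apply continuity_2d_pt_ext with gr; auto.
    - apply filter_forall. intros u. apply ex_RInt_of_continuity_2d. eauto using is_C1_continuity. }
  destruct (MVT_gen (fun r => turn_integral (fun t => g r t)) 0 r (fun _ => 0))
    as (c & _ & Hc).
  - intros; apply D.
  - intros. apply continuity_pt_filterlim. apply (ex_derive_continuous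
      (fun r => turn_integral (fun t => g r t))). exists 0; apply D.
  - lra.
Qed.

Lemma is_C1_cos : is_C1 (fun _ t => cos t) (fun _ _ => 0) (fun _ t => - sin t).
Proof.
  apply is_C1_snd; intros t.
  - apply is_derive_Reals. apply derivable_pt_lim_cos.
  - apply (continuous_opp sin). apply continuous_sin.
Qed.

Lemma is_C1_sin : is_C1 (fun _ t => sin t) (fun _ _ => 0) (fun _ t => cos t).
Proof.
  apply is_C1_snd; intros t.
  - apply is_derive_Reals. apply derivable_pt_lim_sin.
  - apply continuous_cos.
Qed.

Lemma is_C1_polar f fx fy x0 y0 :
  is_C1 f fx fy ->
  is_C1 (fun r t => f (x0 + r * cos t) (y0 + r * sin t))
    (fun r t => fx (x0 + r * cos t) (y0 + r * sin t) * cos t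
                + fy (x0 + r * cos t) (y0 + r * sin t) * sin t)
    (fun r t => - (r * fx (x0 + r * cos t) (y0 + r * sin t) * sin t)
                + r * fy (x0 + r * cos t) (y0 + r * sin t) * cos t).
Proof.
  intros F. eapply is_C1_ext.
  - eapply is_C1_comp. exact F.
    + apply is_C1_plus. apply is_C1_const. apply is_C1_mult. apply is_C1_x. apply is_C1_cos.
    + apply is_C1_plus. apply is_C1_const. apply is_C1_mult. apply is_C1_x. apply is_C1_sin.
  - reflexivity.
  - intros; simpl; ring.
  - intros; simpl; ring.
Qed.

(** The circulation of a closed C^1 form a dx + b dy around a circle vanishes: its
    radial derivative is the integral of the angular derivative of
    a cos t + b sin t, and it is 0 for r = 0. *)
Lemma closed_form_circle a ax ay b bx b_y x0 y0 r :
  is_C1 a ax ay -> is_C1 b bx b_y -> (forall x y, ay x y = bx x y) ->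
  turn_integral (fun t => r * (b (x0 + r * cos t) (y0 + r * sin t) * cos t
                      - a (x0 + r * cos t) (y0 + r * sin t) * sin t)) = 0.
Proof.
  intros A B E.
  pose proof (is_C1_polar _ _ _ x0 y0 A) as PA.
  pose proof (is_C1_polar _ _ _ x0 y0 B) as PB.
  pose proof (is_C1_mult _ _ _ _ _ _ is_C1_x
    (is_C1_minus _ _ _ _ _ _ (is_C1_mult _ _ _ _ _ _ PB is_C1_cos)
                             (is_C1_mult _ _ _ _ _ _ PA is_C1_sin))) as G.
  pose proof (is_C1_plus _ _ _ _ _ _ (is_C1_mult _ _ _ _ _ _ PA is_C1_cos)
                             (is_C1_mult _ _ _ _ _ _ PB is_C1_sin)) as K.
  rewrite (turn_integral_radius _ _ _ r G); cbv beta.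
  - rewrite (turn_integral_ext _ (fun _ => 0)) by (intros; ring).
    rewrite turn_integral_const.  ring.
  - intros s. erewrite turn_integral_ext.
    + eapply (turn_integral_derivative _ _ _ s K). cbv beta.
      rewrite cos_2PI, sin_2PI, cos_0, sin_0. reflexivity.
    + intros t. cbv beta. rewrite E.
      ring.
Qed.

(** Here -h_y dx + h_x dy = dk + (a dx + b dy), with k of class C^1 and
    a dx + b dy closed.  Multiplied by r, the radial derivative of the circle mean of
    h is the circulation of this form, hence zero.  No second derivative of h is
    involved, which is what makes the result applicable to weakly harmonic
    functions. *)
Lemma circle_mean_value h hx hy k kx ky a ax ay b bx b_y x0 y0 r :
  is_C1 h hx hy -> is_C1 k kx ky -> is_C1 a ax ay -> is_C1 b bx b_y ->
  (forall x y, hx x y = ky x y + b x y) ->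
  (forall x y, - hy x y = kx x y + a x y) ->
  (forall x y, ay x y = bx x y) ->
  turn_integral (fun t => h (x0 + r * cos t) (y0 + r * sin t)) = 2 * PI * h x0 y0.
Proof.
  intros H K A B E1 E2 E3.
  pose proof (is_C1_polar _ _ _ x0 y0 H) as PH.
  pose proof (is_C1_polar _ _ _ x0 y0 K) as PK.
  rewrite (turn_integral_radius _ _ _ r PH); cbv beta.
  - rewrite (turn_integral_ext _ (fun _ => h x0 y0)).
    + rewrite turn_integral_const. ring.
    + intros. now rewrite !Rmult_0_l, !Rplus_0_r.
  - clear r. intros r. destruct (Req_dec r 0) as [-> | Hr].
    + rewrite (turn_integral_ext _ (fun t =>
        0 * sin t + hx x0 y0 * cos t - (0 * cos t + hy x0 y0 * - sin t))).
      * pose proof (is_C1_minus _ _ _ _ _ _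
          (is_C1_mult _ _ _ _ _ _ (is_C1_const (hx x0 y0)) is_C1_sin)
          (is_C1_mult _ _ _ _ _ _ (is_C1_const (hy x0 y0)) is_C1_cos)) as L.
        apply (turn_integral_derivative _ _ _ 0 L). cbv beta.
        rewrite cos_2PI, sin_2PI, cos_0, sin_0. reflexivity.
      * intros. rewrite !Rmult_0_l, !Rplus_0_r. ring.
    + apply (Rmult_eq_reg_l r); [|exact Hr]. rewrite Rmult_0_r.
      pose proof (closed_form_circle _ _ _ _ _ _ x0 y0 r A B E3) as J.
      pose proof (turn_integral_derivative _ _ _ r PK) as P. cbv beta in P.
      rewrite cos_2PI, sin_2PI, cos_0, sin_0 in P. specialize (P eq_refl).
      transitivity (0 + 0); [|ring]. rewrite <- P at 1. rewrite <- J.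
      apply turn_integral_combination.
      * apply (ex_RInt_of_continuity_2d (fun r t => hx (x0 + r * cos t) (y0 + r * sin t) * cos t +
          hy (x0 + r * cos t) (y0 + r * sin t) * sin t)). apply PH.
      * apply (ex_RInt_of_continuity_2d (fun r t =>
          - (r * kx (x0 + r * cos t) (y0 + r * sin t) * sin t) +
          r * ky (x0 + r * cos t) (y0 + r * sin t) * cos t)). apply PK.
      * apply (ex_RInt_of_continuity_2d (fun r t => r * (b (x0 + r * cos t) (y0 + r * sin t) * cos t
             - a (x0 + r * cos t) (y0 + r * sin t) * sin t))).
        intros t. eapply is_C1_continuity.
        apply is_C1_mult. apply is_C1_x. apply is_C1_minus.
        -- apply is_C1_mult. apply is_C1_polar. exact B. apply is_C1_cos.
        -- apply is_C1_mult. apply is_C1_polar. exact A. apply is_C1_sin.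
      * intros t. rewrite E1.
        replace (hy (x0 + r * cos t) (y0 + r * sin t)) with
          (- (kx (x0 + r * cos t) (y0 + r * sin t) + a (x0 + r * cos t) (y0 + r * sin t)))
          by (rewrite <- E2; ring). ring.
Qed.

Definition tends_at_infinity (h : R -> R -> R) (l : R) : Prop :=
  forall eps, 0 < eps -> exists M, forall x y, M < x ^ 2 + y ^ 2 -> Rabs (h x y - l) < eps.

Lemma tends_at_infinity_eventually f g l :
  (forall x y, x ^ 2 + y ^ 2 <> 0 -> f x y = g x y) ->
  tends_at_infinity f l -> tends_at_infinity g l.
Proof.
  intros E T eps He. destruct (T eps He) as [M HM]. exists (Rmax 0 M). intros x y H.
  rewrite <- E.
  - apply HM. eapply Rle_lt_trans; [apply Rmax_r|exact H].
  - apply Rgt_not_eq. eapply Rle_lt_trans; [apply Rmax_l|exact H].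
Qed.

Lemma tends_at_infinity_linear f g h a b c lf lg lh :
  tends_at_infinity f lf -> tends_at_infinity g lg -> tends_at_infinity h lh ->
  tends_at_infinity (fun x y => f x y + a * g x y + b * h x y + c)
    (lf + a * lg + b * lh + c).
Proof.
  intros F G H eps He.
  assert (A := Rabs_pos a). assert (B := Rabs_pos b).
  assert (He' : 0 < eps / (1 + Rabs a + Rabs b)) by (apply Rdiv_lt_0_compat; lra).
  set (e := eps / (1 + Rabs a + Rabs b)) in *.
  destruct (F e He') as [M1 H1]. destruct (G e He') as [M2 H2]. destruct (H e He') as [M3 H3].
  exists (Rmax M1 (Rmax M2 M3)). intros x y L.
  specialize (H1 x y ltac:(eapply Rle_lt_trans; [apply Rmax_l|exact L])).
  assert (L' : Rmax M2 M3 < x ^ 2 + y ^ 2) by (eapply Rle_lt_trans; [apply Rmax_r|exact L]).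
  specialize (H2 x y ltac:(eapply Rle_lt_trans; [apply Rmax_l|exact L'])).
  specialize (H3 x y ltac:(eapply Rle_lt_trans; [apply Rmax_r|exact L'])).
  replace (f x y + a * g x y + b * h x y + c - (lf + a * lg + b * lh + c)) with
    ((f x y - lf) + (a * (g x y - lg) + b * (h x y - lh))) by ring.
  eapply Rle_lt_trans; [apply Rabs_triang|].
  eapply Rle_lt_trans; [apply Rplus_le_compat_l, Rabs_triang|].
  rewrite !Rabs_mult.
  replace eps with (e + (Rabs a * e + Rabs b * e)) by (unfold e; field; lra).
  assert (Rabs a * Rabs (g x y - lg) <= Rabs a * e) by (apply Rmult_le_compat_l; lra).
  assert (Rabs b * Rabs (h x y - lh) <= Rabs b * e) by (apply Rmult_le_compat_l; lra).
  lra.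
Qed.

(** The mean over a large circle about any point is close to the limit, and equals
    the value at the point. *)
Lemma harmonic_liouville h hx hy k kx ky a ax ay b bx b_y l :
  is_C1 h hx hy -> is_C1 k kx ky -> is_C1 a ax ay -> is_C1 b bx b_y ->
  (forall x y, hx x y = ky x y + b x y) ->
  (forall x y, - hy x y = kx x y + a x y) ->
  (forall x y, ay x y = bx x y) ->
  tends_at_infinity h l -> forall x y, h x y = l.
Proof.
  intros H K A B E1 E2 E3 L x0 y0.
  pose proof PI_RGT_0 as Hpi.
  apply cond_eq. intros eps He.
  destruct (L (eps / 2)) as [M HM]. lra.
  (* The circle of centre (x0, y0) and radius 2 s lies outside the disc of radius sqrt M. *)
  set (s := 1 + Rabs M + Rabs x0 + Rabs y0).
  assert (Hs : forall t, M < (x0 + 2 * s * cos t) ^ 2 + (y0 + 2 * s * sin t) ^ 2).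
  { intros t. generalize (sin2_cos2 t). unfold Rsqr. intros SC.
    assert (0 <= Rabs M) by apply Rabs_pos. assert (M <= Rabs M) by apply Rle_abs.
    assert (X1 : Rabs x0 ^ 2 = x0 ^ 2) by apply pow2_abs.
    assert (Y1 : Rabs y0 ^ 2 = y0 ^ 2) by apply pow2_abs.
    assert (0 <= Rabs x0) by apply Rabs_pos. assert (0 <= Rabs y0) by apply Rabs_pos.
    assert (S1 : 1 + Rabs M <= s) by (unfold s; lra).
    assert (S2 : x0 ^ 2 + y0 ^ 2 <= s ^ 2).
    { rewrite <- X1, <- Y1. unfold s. nra. }
    set (c := cos t) in *. set (d := sin t) in *.
    assert (0 <= (x0 + s * c) ^ 2 + (y0 + s * d) ^ 2)
      by (apply Rplus_le_le_0_compat; apply pow2_ge_0).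
    assert (Q : (x0 + 2 * s * c) ^ 2 + (y0 + 2 * s * d) ^ 2 =
        2 * ((x0 + s * c) ^ 2 + (y0 + s * d) ^ 2) + 2 * s ^ 2 * (d * d + c * c)
          - (x0 ^ 2 + y0 ^ 2)) by ring.
    rewrite Q, SC.
    assert (1 + Rabs M <= s ^ 2) by (clearbody s; nra). lra. }
  assert (MV := circle_mean_value _ _ _ _ _ _ _ _ _ _ _ _ x0 y0 (2 * s) H K A B E1 E2 E3).
  assert (I : ex_RInt (fun t => h (x0 + 2 * s * cos t) (y0 + 2 * s * sin t)) 0 (2 * PI)).
  { apply (ex_RInt_of_continuity_2d (fun s t => h (x0 + s * cos t) (y0 + s * sin t))).
    intros t. eapply is_C1_continuity. now apply is_C1_polar, H. }
  assert (B1 : turn_integral (fun t => h (x0 + 2 * s * cos t) (y0 + 2 * s * sin t))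
     <= turn_integral (fun t => l + eps / 2)).
  { apply RInt_le. lra. exact I. apply ex_RInt_const.
    intros t _. specialize (HM _ _ (Hs t)). apply Rabs_def2 in HM. lra. }
  assert (B2 : turn_integral (fun t => l - eps / 2) <=
     turn_integral (fun t => h (x0 + 2 * s * cos t) (y0 + 2 * s * sin t))).
  { apply RInt_le. lra. apply ex_RInt_const. exact I.
    intros t _. specialize (HM _ _ (Hs t)). apply Rabs_def2 in HM. lra. }
  rewrite turn_integral_const in B1, B2. rewrite MV in B1, B2.
  apply Rabs_def1; nra.
Qed.

Lemma cauchy_riemann_liouville h hx hy k kx ky l :
  is_C1 h hx hy -> is_C1 k kx ky ->
  (forall x y, hx x y = ky x y) -> (forall x y, hy x y = - kx x y) ->
  tends_at_infinity h l -> forall x y, h x y = l.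
Proof.
  intros H K E1 E2. pose proof (is_C1_const 0) as Z.
  apply (harmonic_liouville _ _ _ _ _ _ _ _ _ _ _ _ l H K Z Z).
  - intros; rewrite E1; ring.
  - intros; rewrite E2; ring.
  - reflexivity.
Qed.

(** The two differential equations say that (a - i b) / u^2 satisfies the
    Cauchy-Riemann equations. *)
Lemma weighted_liouville u ux uy a ax ay b bx b_y :
  is_C1 u ux uy -> is_C1 a ax ay -> is_C1 b bx b_y ->
  (forall x y, u x y <> 0) ->
  (forall x y, u x y * (ax x y + b_y x y) = 2 * (ux x y * a x y + uy x y * b x y)) ->
  (forall x y, u x y * (ay x y - bx x y) = 2 * (uy x y * a x y - ux x y * b x y)) ->
  tends_at_infinity (fun x y => a x y / u x y ^ 2) 0 ->
  tends_at_infinity (fun x y => b x y / u x y ^ 2) 0 ->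
  forall x y, a x y = 0 /\ b x y = 0.
Proof.
  intros U A B N E1 E2 T1 T2.
  assert (V : forall x y, u x y ^ 2 <> 0) by (intros; now apply pow_nonzero).
  pose proof (is_C1_div _ _ _ _ _ _ A (is_C1_sqr _ _ _ U) V) as HA.
  pose proof (is_C1_div _ _ _ _ _ _ B (is_C1_sqr _ _ _ U) V) as HB.
  assert (C1 : forall x y,
    (ax x y * u x y ^ 2 - a x y * (2 * u x y * ux x y)) / (u x y ^ 2) ^ 2 =
    - ((b_y x y * u x y ^ 2 - b x y * (2 * u x y * uy x y)) / (u x y ^ 2) ^ 2)).
  { intros x y. apply Rminus_diag_uniq.
    transitivity ((u x y * (ax x y + b_y x y) - 2 * (ux x y * a x y + uy x y * b x y)) / u x y ^ 3).
    - field; apply N.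
    - rewrite E1. field; apply N. }
  assert (C2 : forall x y,
    (ay x y * u x y ^ 2 - a x y * (2 * u x y * uy x y)) / (u x y ^ 2) ^ 2 =
    (bx x y * u x y ^ 2 - b x y * (2 * u x y * ux x y)) / (u x y ^ 2) ^ 2).
  { intros x y. apply Rminus_diag_uniq.
    transitivity ((u x y * (ay x y - bx x y) - 2 * (uy x y * a x y - ux x y * b x y)) / u x y ^ 3).
    - field; apply N.
    - rewrite E2. field; apply N. }
  assert (Z : forall a b, b <> 0 -> a / b = 0 -> a = 0).
  { intros p q Hq E. replace p with (p / q * q) by (field; exact Hq). rewrite E; ring. }
  intros x y. split; apply (Z _ (u x y ^ 2) (V x y)); revert x y.
  - apply (cauchy_riemann_liouville _ _ _ _ _ _ 0 HA (is_C1_opp _ _ _ HB)); [exact C1| |exact T1].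
    intros x y. cbv beta. rewrite C2. ring.
  - apply (cauchy_riemann_liouville _ _ _ _ _ _ 0 HB HA); [| |exact T2].
    + intros x y. symmetry. apply C2.
    + intros x y. cbv beta. rewrite C1. ring.
Qed.

(** * Vectors and vector-valued functions *)

Definition smul (a : R) (u : R3) : R3 := (a * p1 u, a * p2 u, a * p3 u).

Definition vadd (u v : R3) : R3 := (p1 u + p1 v, p2 u + p2 v, p3 u + p3 v).

(** Combinations of three vectors, since identities are mostly written in a moving
    frame. *)
Definition comb (a : R) (u : R3) (b : R) (v : R3) (c : R) (w : R3) : R3 :=
  (a * p1 u + b * p1 v + c * p1 w,
   a * p2 u + b * p2 v + c * p2 w,
   a * p3 u + b * p3 v + c * p3 w).

Lemma R3_ext u v : p1 u = p1 v -> p2 u = p2 v -> p3 u = p3 v -> u = v.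
Proof.
  destruct u as [[? ?] ?], v as [[? ?] ?]; unfold p1, p2, p3; simpl; congruence.
Qed.

Ltac R3_ring :=
  intros; apply R3_ext;
  unfold vadd, dot, cross, comb, smul, p1, p2, p3; simpl; ring.

Lemma dot_comm u v : dot u v = dot v u.
Proof. unfold dot. ring. Qed.

Lemma dot_comb a u b v c w t :
  dot (comb a u b v c w) t = a * dot u t + b * dot v t + c * dot w t.
Proof. unfold dot, comb, p1, p2, p3; simpl. ring. Qed.

Lemma dot_comb_r a u b v c w t :
  dot t (comb a u b v c w) = a * dot t u + b * dot t v + c * dot t w.
Proof. unfold dot, comb, p1, p2, p3; simpl. ring. Qed.

Lemma dot_smul a u v : dot (smul a u) v = a * dot u v.
Proof. unfold dot, smul, p1, p2, p3; simpl. ring. Qed.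

Lemma dot_vadd u v w : dot (vadd u v) w = dot u w + dot v w.
Proof. unfold dot, vadd, p1, p2, p3; simpl. ring. Qed.

Lemma dot_e3 u : dot u e3 = p3 u.
Proof. unfold dot, e3, p1, p2, p3; simpl. ring. Qed.

Lemma dot_coordinates n : dot e1 n = p1 n /\ dot e2 n = p2 n /\ dot e3 n = p3 n.
Proof. unfold dot, e1, e2, e3, p1, p2, p3; simpl. repeat split; ring. Qed.

Lemma p3_comb a u b v c w : p3 (comb a u b v c w) = a * p3 u + b * p3 v + c * p3 w.
Proof. reflexivity. Qed.

Lemma triple_rotate u v w : dot (cross u v) w = dot u (cross v w).
Proof. unfold dot, cross, p1, p2, p3; simpl. ring. Qed.

Lemma triple_cycle u v w : dot u (cross v w) = dot v (cross w u).
Proof. unfold dot, cross, p1, p2, p3; simpl. ring. Qed.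

Lemma cross_cross u v w :
  cross (cross u v) w = comb (dot u w) v (- dot v w) u 0 u.
Proof. R3_ring. Qed.

Lemma cross_comb u a v b w c z :
  cross u (comb a v b w c z) = comb a (cross u v) b (cross u w) c (cross u z).
Proof. R3_ring. Qed.

Lemma cross_self v : cross v v = smul 0 v.
Proof. R3_ring. Qed.

Lemma smul_inj a u v : a <> 0 -> smul a u = smul a v -> u = v.
Proof.
  intros A E. unfold smul in E. injection E. intros.
  apply R3_ext; apply (Rmult_eq_reg_l a); assumption.
Qed.

Definition is_C1v (u ux uy : R -> R -> R3) : Prop :=
  is_C1 (fun x y => p1 (u x y)) (fun x y => p1 (ux x y)) (fun x y => p1 (uy x y)) /\
  is_C1 (fun x y => p2 (u x y)) (fun x y => p2 (ux x y)) (fun x y => p2 (uy x y)) /\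
  is_C1 (fun x y => p3 (u x y)) (fun x y => p3 (ux x y)) (fun x y => p3 (uy x y)).

Lemma is_C1v_eq f fx fy gx gy :
  is_C1v f fx fy -> (forall x y, fx x y = gx x y) -> (forall x y, fy x y = gy x y) ->
  is_C1v f gx gy.
Proof.
  intros (F1 & F2 & F3) Ex Ey.
  split; [|split]; (eapply is_C1_eq; [eassumption| |]); intros x y; cbv beta;
    now rewrite ?Ex, ?Ey.
Qed.

Lemma is_C1_dot u ux uy v vx vy :
  is_C1v u ux uy -> is_C1v v vx vy ->
  is_C1 (fun x y => dot (u x y) (v x y))
    (fun x y => dot (ux x y) (v x y) + dot (u x y) (vx x y))
    (fun x y => dot (uy x y) (v x y) + dot (u x y) (vy x y)).
Proof.
  intros (U1 & U2 & U3) (V1 & V2 & V3). eapply is_C1_ext.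
  - apply is_C1_plus. apply is_C1_plus.
    + apply (is_C1_mult _ _ _ _ _ _ U1 V1).
    + apply (is_C1_mult _ _ _ _ _ _ U2 V2).
    + apply (is_C1_mult _ _ _ _ _ _ U3 V3).
  - reflexivity.
  - intros; unfold dot; ring.
  - intros; unfold dot; ring.
Qed.

Lemma is_C1v_cross u ux uy v vx vy :
  is_C1v u ux uy -> is_C1v v vx vy ->
  is_C1v (fun x y => cross (u x y) (v x y))
    (fun x y => vadd (cross (ux x y) (v x y)) (cross (u x y) (vx x y)))
    (fun x y => vadd (cross (uy x y) (v x y)) (cross (u x y) (vy x y))).
Proof.
  intros (U1 & U2 & U3) (V1 & V2 & V3).
  split; [|split]; (eapply is_C1_eq;
    [unfold cross, p1 at 1, p2 at 1, p3 at 1; cbn [fst snd]; C1_solve | |]);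
    intros; unfold vadd, cross, p1, p2, p3; simpl; ring.
Qed.

Lemma is_C1v_comb a ax ay u ux uy b bx b_y v vx vy c cx cy w wx wy :
  is_C1 a ax ay -> is_C1v u ux uy -> is_C1 b bx b_y -> is_C1v v vx vy ->
  is_C1 c cx cy -> is_C1v w wx wy ->
  is_C1v (fun x y => comb (a x y) (u x y) (b x y) (v x y) (c x y) (w x y))
    (fun x y => vadd (comb (ax x y) (u x y) (bx x y) (v x y) (cx x y) (w x y))
                     (comb (a x y) (ux x y) (b x y) (vx x y) (c x y) (wx x y)))
    (fun x y => vadd (comb (ay x y) (u x y) (b_y x y) (v x y) (cy x y) (w x y))
                     (comb (a x y) (uy x y) (b x y) (vy x y) (c x y) (wy x y))).
Proof.
  intros A (U1 & U2 & U3) B (V1 & V2 & V3) C (W1 & W2 & W3).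
  split; [|split]; (eapply is_C1_eq;
    [unfold comb, p1 at 1, p2 at 1, p3 at 1; cbn [fst snd]; C1_solve | |]);
    intros; unfold vadd, comb, p1, p2, p3; simpl; ring.
Qed.

Lemma is_C1v_neg u ux uy :
  is_C1v u ux uy ->
  is_C1v (fun x y => smul (-1) (u x y)) (fun x y => smul (-1) (ux x y))
    (fun x y => smul (-1) (uy x y)).
Proof.
  intros (U1 & U2 & U3).
  split; [|split]; (eapply is_C1_eq;
    [unfold smul, p1 at 1, p2 at 1, p3 at 1; cbn [fst snd]; C1_solve | |]);
    intros; unfold smul, p1, p2, p3; simpl; ring.
Qed.

Lemma harmonic_liouville_v h hx hy k kx ky a ax ay b bx b_y l :
  is_C1v h hx hy -> is_C1v k kx ky -> is_C1v a ax ay -> is_C1v b bx b_y ->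
  (forall x y, hx x y = vadd (ky x y) (b x y)) ->
  (forall x y, smul (-1) (hy x y) = vadd (kx x y) (a x y)) ->
  (forall x y, ay x y = bx x y) ->
  tends_at_infinity (fun x y => p1 (h x y)) (p1 l) ->
  tends_at_infinity (fun x y => p2 (h x y)) (p2 l) ->
  tends_at_infinity (fun x y => p3 (h x y)) (p3 l) ->
  forall x y, h x y = l.
Proof.
  intros (H1 & H2 & H3) (K1 & K2 & K3) (A1 & A2 & A3) (B1 & B2 & B3) E1 E2 E3 T1 T2 T3 x y.
  apply R3_ext; revert x y.
  - apply (harmonic_liouville _ _ _ _ _ _ _ _ _ _ _ _ _ H1 K1 A1 B1); [| | |exact T1];
      intros x y; [now rewrite E1| |now rewrite E3].
    assert (E := f_equal p1 (E2 x y)). unfold smul, vadd, p1 in *; simpl in *. lra.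
  - apply (harmonic_liouville _ _ _ _ _ _ _ _ _ _ _ _ _ H2 K2 A2 B2); [| | |exact T2];
      intros x y; [now rewrite E1| |now rewrite E3].
    assert (E := f_equal p2 (E2 x y)). unfold smul, vadd, p2 in *; simpl in *. lra.
  - apply (harmonic_liouville _ _ _ _ _ _ _ _ _ _ _ _ _ H3 K3 A3 B3); [| | |exact T3];
      intros x y; [now rewrite E1| |now rewrite E3].
    assert (E := f_equal p3 (E2 x y)). unfold smul, vadd, p3 in *; simpl in *. lra.
Qed.

Record C2_field := {
  fld : R -> R -> R3;
  fld_x : R -> R -> R3;
  fld_y : R -> R -> R3;
  fld_xx : R -> R -> R3;
  fld_xy : R -> R -> R3;
  fld_yy : R -> R -> R3;
  fld_C1 : is_C1v fld fld_x fld_y;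
  fld_x_C1 : is_C1v fld_x fld_xx fld_xy;
  fld_y_C1 : is_C1v fld_y fld_xy fld_yy
}.

Definition constant_field (e : R3) : C2_field.
Proof.
  refine (Build_C2_field (fun _ _ => e) (fun _ _ => (0, 0, 0)) (fun _ _ => (0, 0, 0))
    (fun _ _ => (0, 0, 0)) (fun _ _ => (0, 0, 0)) (fun _ _ => (0, 0, 0)) _ _ _);
  (split; [|split]); apply is_C1_const.
Defined.

(** * Conformal maps onto the unit sphere *)

(** A conformal map [nrm] from the plane to the unit sphere with its moving frame.
    The functions [log_x] and [log_y] are the derivatives of log(rho) / 2.  The second
    derivatives of [nrm] are the ones forced by the frame equations of a conformal
    immersion of the unit sphere, and [nrm_cross] fixes the orientation: it is the one
    of the inverse stereographic projection from the north pole. *)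
Record sphere_chart := {
  nrm : R -> R -> R3;
  nrm_x : R -> R -> R3;
  nrm_y : R -> R -> R3;
  rho : R -> R -> R;
  log_x : R -> R -> R;
  log_y : R -> R -> R;
  rho_pos : forall x y, 0 < rho x y;
  rho_C1 : is_C1 rho (fun x y => 2 * rho x y * log_x x y) (fun x y => 2 * rho x y * log_y x y);
  log_x_C1 : exists dx dy, is_C1 log_x dx dy;
  log_y_C1 : exists dx dy, is_C1 log_y dx dy;
  nrm_C1 : is_C1v nrm nrm_x nrm_y;
  nrm_x_C1 : is_C1v nrm_x
    (fun x y => comb (- rho x y) (nrm x y) (log_x x y) (nrm_x x y) (- log_y x y) (nrm_y x y))
    (fun x y => comb 0 (nrm x y) (log_y x y) (nrm_x x y) (log_x x y) (nrm_y x y));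
  nrm_y_C1 : is_C1v nrm_y
    (fun x y => comb 0 (nrm x y) (log_y x y) (nrm_x x y) (log_x x y) (nrm_y x y))
    (fun x y => comb (- rho x y) (nrm x y) (- log_x x y) (nrm_x x y) (log_y x y) (nrm_y x y));
  nrm_unit : forall x y, dot (nrm x y) (nrm x y) = 1;
  nrm_xx : forall x y, dot (nrm_x x y) (nrm_x x y) = rho x y;
  nrm_yy : forall x y, dot (nrm_y x y) (nrm_y x y) = rho x y;
  nrm_xy : forall x y, dot (nrm_x x y) (nrm_y x y) = 0;
  nrm_cross : forall x y, cross (nrm_x x y) (nrm_y x y) = smul (- rho x y) (nrm x y)
}.

Lemma rho_neq_0 S x y : rho S x y <> 0.
Proof. apply Rgt_not_eq, rho_pos. Qed.

Lemma nrm_bounds S x y : -1 <= p3 (nrm S x y) <= 1.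
Proof.
  generalize (nrm_unit S x y). unfold dot. intros. nra.
Qed.

Lemma nrm_dot_x S x y : dot (nrm S x y) (nrm_x S x y) = 0.
Proof.
  apply (Rmult_eq_reg_l (- rho S x y)).
  - rewrite <- dot_smul, <- nrm_cross, triple_rotate. unfold dot, cross, p1, p2, p3; simpl. ring.
  - generalize (rho_pos S x y); lra.
Qed.

Lemma nrm_dot_y S x y : dot (nrm S x y) (nrm_y S x y) = 0.
Proof.
  apply (Rmult_eq_reg_l (- rho S x y)).
  - rewrite <- dot_smul, <- nrm_cross, triple_rotate. unfold dot, cross, p1, p2, p3; simpl. ring.
  - generalize (rho_pos S x y); lra.
Qed.

Lemma cross_n_x S x y : cross (nrm S x y) (nrm_x S x y) = smul (-1) (nrm_y S x y).
Proof.
  apply (smul_inj (- rho S x y)). generalize (rho_pos S x y); lra.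
  transitivity (cross (smul (- rho S x y) (nrm S x y)) (nrm_x S x y)).
  - R3_ring.
  - rewrite <- nrm_cross, cross_cross, nrm_xx, (dot_comm (nrm_y S x y)), nrm_xy.
    R3_ring.
Qed.

Lemma cross_n_y S x y : cross (nrm S x y) (nrm_y S x y) = nrm_x S x y.
Proof.
  apply (smul_inj (- rho S x y)). generalize (rho_pos S x y); lra.
  transitivity (cross (smul (- rho S x y) (nrm S x y)) (nrm_y S x y)).
  - R3_ring.
  - rewrite <- nrm_cross, cross_cross, nrm_yy, nrm_xy.
    R3_ring.
Qed.

Lemma cross_y_n S x y : cross (nrm_y S x y) (nrm S x y) = smul (-1) (nrm_x S x y).
Proof.
  rewrite <- cross_n_y. R3_ring.
Qed.

Lemma cross_y_x S x y : cross (nrm_y S x y) (nrm_x S x y) = smul (rho S x y) (nrm S x y).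
Proof.
  replace (cross (nrm_y S x y) (nrm_x S x y)) with (smul (-1) (cross (nrm_x S x y) (nrm_y S x y))).
  - rewrite nrm_cross. R3_ring.
  - R3_ring.
Qed.

(** Cramer's rule in the basis n_x, n_y, n, whose cross products are known. *)
Lemma frame_decomposition S x y v :
  smul (rho S x y) v =
  comb (rho S x y * dot v (nrm S x y)) (nrm S x y)
    (dot v (nrm_x S x y)) (nrm_x S x y) (dot v (nrm_y S x y)) (nrm_y S x y).
Proof.
  set (n := nrm S x y). set (nx := nrm_x S x y). set (ny := nrm_y S x y).
  assert (C1 : cross nx ny = smul (- rho S x y) n) by apply nrm_cross.
  assert (C2 : cross n nx = smul (-1) ny) by apply cross_n_x.
  assert (C3 : cross n ny = nx) by apply cross_n_y.
  assert (Dt : dot (cross nx ny) n = - rho S x y).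
  { rewrite C1, dot_smul. unfold n. rewrite nrm_unit. ring. }
  assert (K : smul (dot (cross nx ny) n) v =
    comb (dot v (cross ny n)) nx (dot v (cross n nx)) ny (dot v (cross nx ny)) n).
  { R3_ring. }
  rewrite Dt, C1, C2 in K.
  replace (cross ny n) with (smul (-1) nx) in K.
  2:{ rewrite <- C3 at 1. R3_ring. }
  rewrite !(dot_comm v), !dot_smul, !(dot_comm _ v) in K.
  clearbody n nx ny. unfold smul, comb, p1, p2, p3 in *; simpl in *.
  injection K. intros K3 K2 K1. repeat apply f_equal2; lra.
Qed.

Lemma frame_dot S x y u v :
  rho S x y * dot u v =
  rho S x y * dot u (nrm S x y) * dot v (nrm S x y)
  + dot u (nrm_x S x y) * dot v (nrm_x S x y) + dot u (nrm_y S x y) * dot v (nrm_y S x y).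
Proof.
  rewrite <- dot_smul, frame_decomposition, dot_comb, !(dot_comm _ v). ring.
Qed.

Lemma frame_height S x y v :
  rho S x y * p3 v =
  rho S x y * dot v (nrm S x y) * p3 (nrm S x y)
  + dot v (nrm_x S x y) * p3 (nrm_x S x y) + dot v (nrm_y S x y) * p3 (nrm_y S x y).
Proof. rewrite <- !dot_e3, (frame_dot S x y v e3), !(dot_comm _ e3). ring. Qed.

(** Components of a vector field in the basis n_x, n_y: read as a complex number, they
    are the tangential part as a vector field on the source plane. *)
Definition tangent_x (S : sphere_chart) (f : R -> R -> R3) (x y : R) : R :=
  dot (f x y) (nrm_x S x y) / rho S x y.

Definition tangent_y (S : sphere_chart) (f : R -> R -> R3) (x y : R) : R :=
  dot (f x y) (nrm_y S x y) / rho S x y.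

Lemma tangential_decomposition S (f : R -> R -> R3) x y :
  f x y = comb (dot (f x y) (nrm S x y)) (nrm S x y)
    (tangent_x S f x y) (nrm_x S x y) (tangent_y S f x y) (nrm_y S x y).
Proof.
  apply (smul_inj (rho S x y)); [apply rho_neq_0|].
  rewrite frame_decomposition. unfold tangent_x, tangent_y.
  apply R3_ext; unfold smul, comb, p1, p2, p3; simpl; field; apply rho_neq_0.
Qed.

Lemma tangent_x_C1 S f fx fy :
  is_C1v f fx fy ->
  is_C1 (tangent_x S f)
    (fun x y => tangent_x S fx x y - dot (f x y) (nrm S x y)
       - log_x S x y * tangent_x S f x y - log_y S x y * tangent_y S f x y)
    (fun x y => tangent_x S fy x y - log_y S x y * tangent_x S f x y
      + log_x S x y * tangent_y S f x y).
Proof.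
  intros F. pose proof (is_C1_dot _ _ _ _ _ _ F (nrm_x_C1 S)) as D.
  pose proof (rho_C1 S) as P.
  eapply is_C1_eq.
  - unfold tangent_x. C1_solve. apply rho_neq_0.
  - intros x y. cbv beta. rewrite dot_comb_r. unfold tangent_x, tangent_y. field. apply rho_neq_0.
  - intros x y. cbv beta. rewrite dot_comb_r. unfold tangent_x, tangent_y. field. apply rho_neq_0.
Qed.

Lemma tangent_y_C1 S f fx fy :
  is_C1v f fx fy ->
  is_C1 (tangent_y S f)
    (fun x y => tangent_y S fx x y + log_y S x y * tangent_x S f x y
      - log_x S x y * tangent_y S f x y)
    (fun x y => tangent_y S fy x y - dot (f x y) (nrm S x y)
       - log_x S x y * tangent_x S f x y - log_y S x y * tangent_y S f x y).
Proof.
  intros F. pose proof (is_C1_dot _ _ _ _ _ _ F (nrm_y_C1 S)) as D.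
  pose proof (rho_C1 S) as P.
  eapply is_C1_eq.
  - unfold tangent_y. C1_solve. apply rho_neq_0.
  - intros x y. cbv beta. rewrite dot_comb_r. unfold tangent_x, tangent_y. field. apply rho_neq_0.
  - intros x y. cbv beta. rewrite dot_comb_r. unfold tangent_x, tangent_y. field. apply rho_neq_0.
Qed.

(** * Inversion of the plane *)

Definition inv_re (x y : R) : R := x / (x ^ 2 + y ^ 2).

Definition inv_im (x y : R) : R := - y / (x ^ 2 + y ^ 2).

(** [g] is [f] in the coordinate w = 1/z. *)
Definition inverted {T} (f g : R -> R -> T) : Prop :=
  forall x y, x ^ 2 + y ^ 2 <> 0 -> f x y = g (inv_re x y) (inv_im x y).

Lemma inv_sqr x y : x ^ 2 + y ^ 2 <> 0 -> inv_re x y ^ 2 + inv_im x y ^ 2 = / (x ^ 2 + y ^ 2).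
Proof. intros H. unfold inv_re, inv_im. field. lra. Qed.

Lemma inverted_sym {A} (f g : R -> R -> A) : inverted f g -> inverted g f.
Proof.
  intros I x y N. rewrite I.
  - f_equal; symmetry.
    + unfold inv_re at 1. rewrite inv_sqr by exact N. unfold inv_re. field. exact N.
    + unfold inv_im at 1. rewrite inv_sqr by exact N. unfold inv_im. field. exact N.
  - rewrite inv_sqr by exact N. now apply Rinv_neq_0_compat.
Qed.

Lemma sqr_lt_Rabs a b : 0 < b -> a ^ 2 < b ^ 2 -> Rabs a < b.
Proof. intros B H. apply Rabs_def1; nra. Qed.

Lemma inverted_limit f g :
  inverted f g -> continuity_2d_pt g 0 0 -> tends_at_infinity f (g 0 0).
Proof.
  intros I C eps He. destruct (C (mkposreal eps He)) as [d Hd]. simpl in Hd.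
  exists (Rmax 0 (/ (d * d))). intros x y H.
  assert (H1 := Rle_lt_trans _ _ _ (Rmax_l _ _) H).
  assert (H2 := Rle_lt_trans _ _ _ (Rmax_r _ _) H).
  assert (P := cond_pos d).
  assert (Q : / (x ^ 2 + y ^ 2) < d ^ 2).
  { replace (d ^ 2) with (/ / (d * d)) by (field; lra).
    apply Rinv_lt_contravar; [|exact H2].
    apply Rmult_lt_0_compat; [apply Rinv_0_lt_compat; nra | exact H1]. }
  assert (S := inv_sqr x y ltac:(lra)).
  rewrite I by lra.
  apply Hd; rewrite Rminus_0_r; apply sqr_lt_Rabs; auto.
  - generalize (pow2_ge_0 (inv_im x y)); lra.
  - generalize (pow2_ge_0 (inv_re x y)); lra.
Qed.

Lemma is_derive_inverted_x g gx gy x y :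
  is_C1 g gx gy -> x ^ 2 + y ^ 2 <> 0 ->
  let u := inv_re x y in let v := inv_im x y in
  is_derive (fun t => g (inv_re t y) (inv_im t y)) x
    (- (u ^ 2 - v ^ 2) * gx u v - 2 * u * v * gy u v).
Proof.
  intros G N u v. apply is_derive_Reals.
  replace (- (u ^ 2 - v ^ 2) * gx u v - 2 * u * v * gy u v) with
    (gx u v * - (u ^ 2 - v ^ 2) + gy u v * (- 2 * u * v)) by ring.
  apply (derivable_pt_lim_comp_2d g (fun t => inv_re t y) (fun t => inv_im t y)).
  - now apply is_C1_differentiable.
  - apply is_derive_Reals. unfold inv_re. auto_derive.
    + simpl in *; lra.
    + unfold u, v, inv_re, inv_im. field. simpl in *; lra.
  - apply is_derive_Reals. unfold inv_im. auto_derive.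
    + simpl in *; lra.
    + unfold u, v, inv_re, inv_im. field. simpl in *; lra.
Qed.

Lemma is_derive_inverted_y g gx gy x y :
  is_C1 g gx gy -> x ^ 2 + y ^ 2 <> 0 ->
  let u := inv_re x y in let v := inv_im x y in
  is_derive (fun t => g (inv_re x t) (inv_im x t)) y
    (2 * u * v * gx u v - (u ^ 2 - v ^ 2) * gy u v).
Proof.
  intros G N u v. apply is_derive_Reals.
  replace (2 * u * v * gx u v - (u ^ 2 - v ^ 2) * gy u v) with
    (gx u v * (2 * u * v) + gy u v * - (u ^ 2 - v ^ 2)) by ring.
  apply (derivable_pt_lim_comp_2d g (fun t => inv_re x t) (fun t => inv_im x t)).
  - now apply is_C1_differentiable.
  - apply is_derive_Reals. unfold inv_re. auto_derive.
    + simpl in *; lra.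
    + unfold u, v, inv_re, inv_im. field. simpl in *; lra.
  - apply is_derive_Reals. unfold inv_im. auto_derive.
    + simpl in *; lra.
    + unfold u, v, inv_re, inv_im. field. simpl in *; lra.
Qed.

Lemma punctured_near x y :
  x ^ 2 + y ^ 2 <> 0 ->
  locally x (fun t => t ^ 2 + y ^ 2 <> 0) /\ locally y (fun t => x ^ 2 + t ^ 2 <> 0).
Proof.
  intros N.
  destruct (continuity_2d_pt_neq_0 (fun x y => x ^ 2 + y ^ 2) x y) as [d Hd]; [|exact N|].
  - eapply is_C1_continuity, is_C1_plus; apply is_C1_sqr; [apply is_C1_x|apply is_C1_y].
  - split; exists d; intros t Ht; apply Hd; try exact Ht;
      rewrite Rminus_diag, Rabs_R0; apply cond_pos.
Qed.

(** The chain rule for w = 1/z, with dw/dz = - w^2. *)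
Lemma inverted_derivatives f fx fy g gx gy x y :
  is_C1 f fx fy -> is_C1 g gx gy -> inverted f g -> x ^ 2 + y ^ 2 <> 0 ->
  let u := inv_re x y in let v := inv_im x y in
  fx x y = - (u ^ 2 - v ^ 2) * gx u v - 2 * u * v * gy u v /\
  fy x y = 2 * u * v * gx u v - (u ^ 2 - v ^ 2) * gy u v.
Proof.
  intros F G I N u v. destruct F as (F1 & F2 & _).
  destruct (punctured_near x y N) as [Lx Ly]. split.
  - transitivity (Derive (fun t => f t y) x).
    + symmetry. now apply is_derive_unique.
    + apply is_derive_unique.
      apply is_derive_ext_loc with (fun t => g (inv_re t y) (inv_im t y)).
      * revert Lx. apply filter_imp. intros t Ht. symmetry. now apply I.
      * now apply is_derive_inverted_x.
  - transitivity (Derive (fun t => f x t) y).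
    + symmetry. now apply is_derive_unique.
    + apply is_derive_unique.
      apply is_derive_ext_loc with (fun t => g (inv_re x t) (inv_im x t)).
      * revert Ly. apply filter_imp. intros t Ht. symmetry. now apply I.
      * now apply is_derive_inverted_y.
Qed.

Lemma inverted_derivatives_v f fx fy g gx gy x y :
  is_C1v f fx fy -> is_C1v g gx gy -> inverted f g -> x ^ 2 + y ^ 2 <> 0 ->
  let u := inv_re x y in let v := inv_im x y in
  fx x y = comb (- (u ^ 2 - v ^ 2)) (gx u v) (- (2 * u * v)) (gy u v) 0 e3 /\
  fy x y = comb (2 * u * v) (gx u v) (- (u ^ 2 - v ^ 2)) (gy u v) 0 e3.
Proof.
  intros (F1 & F2 & F3) (G1 & G2 & G3) I N u v.
  assert (I1 : inverted (fun x y => p1 (f x y)) (fun x y => p1 (g x y)))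
    by (intros a b H; cbv beta; now rewrite (I a b H)).
  assert (I2 : inverted (fun x y => p2 (f x y)) (fun x y => p2 (g x y)))
    by (intros a b H; cbv beta; now rewrite (I a b H)).
  assert (I3 : inverted (fun x y => p3 (f x y)) (fun x y => p3 (g x y)))
    by (intros a b H; cbv beta; now rewrite (I a b H)).
  destruct (inverted_derivatives _ _ _ _ _ _ x y F1 G1 I1 N) as [X1 Y1].
  destruct (inverted_derivatives _ _ _ _ _ _ x y F2 G2 I2 N) as [X2 Y2].
  destruct (inverted_derivatives _ _ _ _ _ _ x y F3 G3 I3 N) as [X3 Y3].
  cbv zeta in *. fold u v in X1, X2, X3, Y1, Y2, Y3.
  split; apply R3_ext;
    rewrite ?X1, ?X2, ?X3, ?Y1, ?Y2, ?Y3; unfold comb, p1, p2, p3; simpl; ring.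
Qed.

(** With z = 1/w, the product of z and an error o(w) tends to 0. *)
Lemma inverted_taylor_remainder p px py :
  is_C1 p px py ->
  let rem u v := p u v - p 0 0 - (px 0 0 * u + py 0 0 * v) in
  tends_at_infinity (fun x y => x * rem (inv_re x y) (inv_im x y)) 0 /\
  tends_at_infinity (fun x y => y * rem (inv_re x y) (inv_im x y)) 0.
Proof.
  intros P rem. pose proof (is_C1_differentiable _ _ _ 0 0 P) as D.
  assert (K : forall eps, 0 < eps -> exists M, forall x y, M < x ^ 2 + y ^ 2 ->
     Rabs (rem (inv_re x y) (inv_im x y)) <= eps * / sqrt (x ^ 2 + y ^ 2) /\ 0 < x ^ 2 + y ^ 2).
  { intros eps He. destruct (D (mkposreal eps He)) as [d Hd]. simpl in Hd.
    assert (Pd := cond_pos d).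
    destruct (inverted_limit (fun x y => inv_re x y) (fun u v => u)
      ltac:(intros ? ? ?; reflexivity) (continuity_2d_pt_id1 0 0) d Pd) as [M1 H1].
    destruct (inverted_limit (fun x y => inv_im x y) (fun u v => v)
      ltac:(intros ? ? ?; reflexivity) (continuity_2d_pt_id2 0 0) d Pd) as [M2 H2].
    exists (Rmax 0 (Rmax M1 M2)). intros x y H.
    assert (0 < x ^ 2 + y ^ 2) as S0 by (eapply Rle_lt_trans; [apply Rmax_l|exact H]).
    assert (Rmax M1 M2 < x ^ 2 + y ^ 2) as S1 by (eapply Rle_lt_trans; [apply Rmax_r|exact H]).
    split; [|exact S0].
    specialize (H1 x y ltac:(eapply Rle_lt_trans; [apply Rmax_l|exact S1])).
    specialize (H2 x y ltac:(eapply Rle_lt_trans; [apply Rmax_r|exact S1])).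
    specialize (Hd _ _ H1 H2). rewrite !Rminus_0_r in Hd.
    unfold rem. eapply Rle_trans; [exact Hd|].
    apply Rmult_le_compat_l; [lra|].
    assert (Q := inv_sqr x y ltac:(lra)). rewrite <- sqrt_inv, <- Q.
    apply Rmax_lub; rewrite <- sqrt_Rsqr_abs; apply sqrt_le_1_alt; unfold Rsqr.
    - generalize (pow2_ge_0 (inv_im x y)); lra.
    - generalize (pow2_ge_0 (inv_re x y)); lra. }
  split; intros eps He; destruct (K (eps / 2) ltac:(lra)) as [M HM]; exists M; intros x y H;
    destruct (HM x y H) as [B S0]; rewrite Rminus_0_r, Rabs_mult;
    assert (Q := sqrt_lt_R0 _ S0).
  - assert (Rabs x <= sqrt (x ^ 2 + y ^ 2)).
    { rewrite <- sqrt_Rsqr_abs. apply sqrt_le_1_alt. unfold Rsqr.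
      generalize (pow2_ge_0 y); lra. }
    apply Rle_lt_trans with (sqrt (x ^ 2 + y ^ 2) * (eps / 2 * / sqrt (x ^ 2 + y ^ 2))).
    + apply Rmult_le_compat; auto using Rabs_pos.
    + replace (sqrt (x ^ 2 + y ^ 2) * (eps / 2 * / sqrt (x ^ 2 + y ^ 2))) with (eps / 2); [lra|].
      field; lra.
  - assert (Rabs y <= sqrt (x ^ 2 + y ^ 2)).
    { rewrite <- sqrt_Rsqr_abs. apply sqrt_le_1_alt. unfold Rsqr.
      generalize (pow2_ge_0 x); lra. }
    apply Rle_lt_trans with (sqrt (x ^ 2 + y ^ 2) * (eps / 2 * / sqrt (x ^ 2 + y ^ 2))).
    + apply Rmult_le_compat; auto using Rabs_pos.
    + replace (sqrt (x ^ 2 + y ^ 2) * (eps / 2 * / sqrt (x ^ 2 + y ^ 2))) with (eps / 2); [lra|].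
      field; lra.
Qed.

Lemma rho_inverted S T x y :
  inverted (nrm S) (nrm T) -> x ^ 2 + y ^ 2 <> 0 ->
  let u := inv_re x y in let v := inv_im x y in
  rho S x y = (u ^ 2 + v ^ 2) ^ 2 * rho T u v.
Proof.
  intros I N u v. rewrite <- nrm_xx.
  destruct (inverted_derivatives_v _ _ _ _ _ _ x y (nrm_C1 S) (nrm_C1 T) I N) as [-> _].
  fold u v. rewrite !dot_comb, !dot_comb_r, nrm_xx, nrm_yy.
  rewrite (dot_comm (nrm_y T u v) (nrm_x T u v)), nrm_xy. ring.
Qed.

(** A vector field X d/dz is transformed by X(z) = - z^2 X~(1/z). *)
Lemma tangent_x_inverted S T f g x y :
  inverted (nrm S) (nrm T) -> inverted f g -> x ^ 2 + y ^ 2 <> 0 ->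
  tangent_x S f x y = - ((x ^ 2 - y ^ 2) * tangent_x T g (inv_re x y) (inv_im x y)
                     - 2 * x * y * tangent_y T g (inv_re x y) (inv_im x y)).
Proof.
  intros I If N. unfold tangent_x, tangent_y.
  rewrite (rho_inverted _ _ _ _ I N), (If x y N), inv_sqr by exact N.
  destruct (inverted_derivatives_v _ _ _ _ _ _ x y (nrm_C1 S) (nrm_C1 T) I N) as [-> _].
  rewrite !dot_comb_r.
  assert (P := rho_neq_0 T (inv_re x y) (inv_im x y)). revert P.
  generalize (rho T (inv_re x y) (inv_im x y)).
  generalize (dot (g (inv_re x y) (inv_im x y)) (nrm_x T (inv_re x y) (inv_im x y))).
  generalize (dot (g (inv_re x y) (inv_im x y)) (nrm_y T (inv_re x y) (inv_im x y))).
  intros. unfold inv_re, inv_im. field. split; lra.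
Qed.

(** * Moebius maps as conformal maps onto the sphere *)

Definition affine_re (a b : C) (x y : R) : R := fst a * x - snd a * y + fst b.

Definition affine_im (a b : C) (x y : R) : R := fst a * y + snd a * x + snd b.

Lemma affine_re_C1 a b : is_C1 (affine_re a b) (fun _ _ => fst a) (fun _ _ => - snd a).
Proof.
  eapply is_C1_ext.
  - apply is_C1_plus. apply is_C1_minus.
    + apply (is_C1_mult _ _ _ _ _ _ (is_C1_const (fst a)) is_C1_x).
    + apply (is_C1_mult _ _ _ _ _ _ (is_C1_const (snd a)) is_C1_y).
    + apply (is_C1_const (fst b)).
  - reflexivity.
  - intros; simpl; ring.
  - intros; simpl; ring.
Qed.

Lemma affine_im_C1 a b : is_C1 (affine_im a b) (fun _ _ => snd a) (fun _ _ => fst a).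
Proof.
  eapply is_C1_ext.
  - apply is_C1_plus. apply is_C1_plus.
    + apply (is_C1_mult _ _ _ _ _ _ (is_C1_const (fst a)) is_C1_y).
    + apply (is_C1_mult _ _ _ _ _ _ (is_C1_const (snd a)) is_C1_x).
    + apply (is_C1_const (snd b)).
  - reflexivity.
  - intros; simpl; ring.
  - intros; simpl; ring.
Qed.

Definition moebius_den a b c d x y : R :=
  affine_re a b x y ^ 2 + affine_im a b x y ^ 2 + affine_re c d x y ^ 2 + affine_im c d x y ^ 2.

(** The composition of the Moebius map P/Q, P = az + b, Q = cz + d, with the inverse
    stereographic projection: (2 P conj(Q), |P|^2 - |Q|^2) / (|P|^2 + |Q|^2).  The formula
    is smooth across the zeros of Q. *)
Definition moebius_nrm a b c d x y : R3 :=
  let P1 := affine_re a b x y in let P2 := affine_im a b x y in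
  let Q1 := affine_re c d x y in let Q2 := affine_im c d x y in
  let D := moebius_den a b c d x y in
  (2 * (P1 * Q1 + P2 * Q2) / D, 2 * (P2 * Q1 - P1 * Q2) / D,
   (P1 ^ 2 + P2 ^ 2 - Q1 ^ 2 - Q2 ^ 2) / D).

Definition moebius_det (a b c d : C) : C := (a * d - b * c)%C.

(** Twice the real part of w times the complex z-derivative of the normal divided by the
    determinant: n_z is the determinant times
    (conj(Q)^2 - conj(P)^2, - i (conj(Q)^2 + conj(P)^2), 2 conj(P) conj(Q)) / D^2, with
    D = |P|^2 + |Q|^2.  Since P and Q have antiholomorphic conjugates, n_zz is the
    multiple - 2 D_z / D of n_z. *)
Definition moebius_nrm_along (w : C) a b c d x y : R3 :=
  let P1 := affine_re a b x y in let P2 := affine_im a b x y in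
  let Q1 := affine_re c d x y in let Q2 := affine_im c d x y in
  let D := moebius_den a b c d x y in
  let W1 := fst w in let W2 := snd w in
  let S1 := P1 ^ 2 - P2 ^ 2 in let S2 := - 2 * P1 * P2 in
  let T1 := Q1 ^ 2 - Q2 ^ 2 in let T2 := - 2 * Q1 * Q2 in
  (2 * ((T1 - S1) * W1 - (T2 - S2) * W2) / D ^ 2,
   2 * ((T1 + S1) * W2 + (T2 + S2) * W1) / D ^ 2,
   4 * ((P1 * Q1 - P2 * Q2) * W1 + (P1 * Q2 + P2 * Q1) * W2) / D ^ 2).

Definition moebius_nrm_x a b c d := moebius_nrm_along (moebius_det a b c d) a b c d.

Definition moebius_nrm_y a b c d := moebius_nrm_along (Ci * moebius_det a b c d)%C a b c d.

Definition moebius_rho a b c d x y : R :=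
  4 * (fst (moebius_det a b c d) ^ 2 + snd (moebius_det a b c d) ^ 2) / moebius_den a b c d x y ^ 2.

Definition moebius_log_x a b c d x y : R :=
  - 2 * (fst a * affine_re a b x y + snd a * affine_im a b x y
         + fst c * affine_re c d x y + snd c * affine_im c d x y) / moebius_den a b c d x y.

Definition moebius_log_y a b c d x y : R :=
  - 2 * (fst a * affine_im a b x y - snd a * affine_re a b x y
         + fst c * affine_im c d x y - snd c * affine_re c d x y) / moebius_den a b c d x y.

(** The determinant is a Q - c P at every point.  With its value written in this way,
    all identities for the frame become rational identities in a, c, P and Q alone. *)
Lemma moebius_det_re a b c d x y :
  fst (moebius_det a b c d) =
  fst a * affine_re c d x y - snd a * affine_im c d x y - (fst c * affine_re a b x y
    - snd c * affine_im a b x y).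
Proof. unfold moebius_det, affine_re, affine_im; simpl. ring. Qed.

Lemma moebius_det_im a b c d x y :
  snd (moebius_det a b c d) =
  fst a * affine_im c d x y + snd a * affine_re c d x y - (fst c * affine_im a b x y
    + snd c * affine_re a b x y).
Proof. unfold moebius_det, affine_re, affine_im; simpl. ring. Qed.

Lemma moebius_den_pos a b c d x y : moebius_det a b c d <> 0%C -> 0 < moebius_den a b c d x y.
Proof.
  intros H. assert (P : 0 <= moebius_den a b c d x y).
  { unfold moebius_den. repeat apply Rplus_le_le_0_compat; apply pow2_ge_0. }
  destruct P as [P | P]; [exact P|]. exfalso. apply H.
  assert (affine_re a b x y = 0 /\ affine_im a b x y = 0 /\
    affine_re c d x y = 0 /\ affine_im c d x y = 0)
    as (E1 & E2 & E3 & E4).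
  { unfold moebius_den in P. repeat split; nra. }
  apply injective_projections.
  - rewrite (moebius_det_re a b c d x y), E1, E2, E3, E4. simpl. ring.
  - rewrite (moebius_det_im a b c d x y), E1, E2, E3, E4. simpl. ring.
Qed.

Lemma moebius_den_C1 a b c d :
  is_C1 (moebius_den a b c d)
    (fun x y => 2 * (fst a * affine_re a b x y + snd a * affine_im a b x y
         + fst c * affine_re c d x y + snd c * affine_im c d x y))
    (fun x y => 2 * (fst a * affine_im a b x y - snd a * affine_re a b x y
         + fst c * affine_im c d x y - snd c * affine_re c d x y)).
Proof.
  pose proof (affine_re_C1 a b) as P1. pose proof (affine_im_C1 a b) as P2.
  pose proof (affine_re_C1 c d) as Q1. pose proof (affine_im_C1 c d) as Q2.
  eapply is_C1_ext.
  - apply is_C1_plus. apply is_C1_plus. apply is_C1_plus.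
    + exact (is_C1_mult _ _ _ _ _ _ P1 P1).
    + exact (is_C1_mult _ _ _ _ _ _ P2 P2).
    + exact (is_C1_mult _ _ _ _ _ _ Q1 Q1).
    + exact (is_C1_mult _ _ _ _ _ _ Q2 Q2).
  - intros; unfold moebius_den; ring.
  - intros; cbv beta; ring.
  - intros; cbv beta; ring.
Qed.

Ltac moebius_identity H x y :=
  match type of H with moebius_det ?a ?b ?c ?d <> _ =>
    let N := fresh in
    assert (N := Rgt_not_eq _ _ (moebius_den_pos a b c d x y H));
    unfold comb, smul, cross, dot, moebius_rho, moebius_log_x, moebius_log_y,
      moebius_nrm_x, moebius_nrm_y, moebius_nrm, moebius_nrm_along, p1, p2, p3;
    cbn [fst snd Cmult Ci];
    rewrite ?(moebius_det_re a b c d x y), ?(moebius_det_im a b c d x y);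
    unfold moebius_den in *;
    generalize dependent (affine_re a b x y); generalize dependent (affine_im a b x y);
    generalize dependent (affine_re c d x y); generalize dependent (affine_im c d x y);
    intros; field; exact N
  end.

Lemma moebius_nrm_C1 a b c d :
  moebius_det a b c d <> 0%C -> is_C1v (moebius_nrm a b c d) (moebius_nrm_x a b c d)
    (moebius_nrm_y a b c d).
Proof.
  intros H.
  pose proof (affine_re_C1 a b) as P1. pose proof (affine_im_C1 a b) as P2.
  pose proof (affine_re_C1 c d) as Q1. pose proof (affine_im_C1 c d) as Q2.
  pose proof (moebius_den_C1 a b c d) as D.
  assert (N : forall x y, moebius_den a b c d x y <> 0)
    by (intros; apply Rgt_not_eq, moebius_den_pos, H).
  split; [|split];
    (eapply is_C1_eq;
      [ unfold moebius_nrm, p1, p2, p3; cbn [fst snd]; cbv zeta;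
        C1_solve; exact N
      | | ]); intros x y; cbv beta; moebius_identity H x y.
Qed.

Lemma moebius_nrm_x_C1 a b c d :
  moebius_det a b c d <> 0%C ->
  is_C1v (moebius_nrm_x a b c d)
    (fun x y => comb (- moebius_rho a b c d x y) (moebius_nrm a b c d x y)
      (moebius_log_x a b c d x y) (moebius_nrm_x a b c d x y) (- moebius_log_y a b c d x y) (moebius_nrm_y a b c d x y))
    (fun x y => comb 0 (moebius_nrm a b c d x y)
      (moebius_log_y a b c d x y) (moebius_nrm_x a b c d x y) (moebius_log_x a b c d x y)
        (moebius_nrm_y a b c d x y)).
Proof.
  intros H.
  pose proof (affine_re_C1 a b) as P1. pose proof (affine_im_C1 a b) as P2.
  pose proof (affine_re_C1 c d) as Q1. pose proof (affine_im_C1 c d) as Q2.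
  pose proof (moebius_den_C1 a b c d) as D.
  assert (N : forall x y, moebius_den a b c d x y <> 0)
    by (intros; apply Rgt_not_eq, moebius_den_pos, H).
  split; [|split];
    (eapply is_C1_eq;
      [ unfold moebius_nrm_x, moebius_nrm_along, p1, p2, p3; cbn [fst snd]; cbv zeta;
        C1_solve; intros; apply pow_nonzero, N
      | | ]); intros x y; cbv beta; moebius_identity H x y.
Qed.

Lemma moebius_nrm_y_C1 a b c d :
  moebius_det a b c d <> 0%C ->
  is_C1v (moebius_nrm_y a b c d)
    (fun x y => comb 0 (moebius_nrm a b c d x y)
      (moebius_log_y a b c d x y) (moebius_nrm_x a b c d x y) (moebius_log_x a b c d x y)
        (moebius_nrm_y a b c d x y))
    (fun x y => comb (- moebius_rho a b c d x y) (moebius_nrm a b c d x y)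
      (- moebius_log_x a b c d x y) (moebius_nrm_x a b c d x y)
        (moebius_log_y a b c d x y) (moebius_nrm_y a b c d x y)).
Proof.
  intros H.
  pose proof (affine_re_C1 a b) as P1. pose proof (affine_im_C1 a b) as P2.
  pose proof (affine_re_C1 c d) as Q1. pose proof (affine_im_C1 c d) as Q2.
  pose proof (moebius_den_C1 a b c d) as D.
  assert (N : forall x y, moebius_den a b c d x y <> 0)
    by (intros; apply Rgt_not_eq, moebius_den_pos, H).
  split; [|split];
    (eapply is_C1_eq;
      [ unfold moebius_nrm_y, moebius_nrm_along, p1, p2, p3; cbn [fst snd]; cbv zeta;
        C1_solve; intros; apply pow_nonzero, N
      | | ]); intros x y; cbv beta; moebius_identity H x y.
Qed.

Lemma moebius_rho_C1 a b c d :
  moebius_det a b c d <> 0%C ->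
  is_C1 (moebius_rho a b c d)
    (fun x y => 2 * moebius_rho a b c d x y * moebius_log_x a b c d x y)
    (fun x y => 2 * moebius_rho a b c d x y * moebius_log_y a b c d x y).
Proof.
  intros H. pose proof (moebius_den_C1 a b c d) as D.
  assert (N : forall x y, moebius_den a b c d x y <> 0)
    by (intros; apply Rgt_not_eq, moebius_den_pos, H).
  eapply is_C1_eq; [unfold moebius_rho; C1_solve; intros; apply pow_nonzero, N | |];
    intros x y; unfold moebius_rho, moebius_log_x, moebius_log_y; field; apply N.
Qed.

Lemma moebius_rho_pos a b c d x y : moebius_det a b c d <> 0%C -> 0 < moebius_rho a b c d x y.
Proof.
  intros H. unfold moebius_rho. apply Rdiv_lt_0_compat.
  - apply Rmult_lt_0_compat; [lra|].
    destruct (Req_dec (fst (moebius_det a b c d)) 0) as [E1|E1]; [|nra].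
    destruct (Req_dec (snd (moebius_det a b c d)) 0) as [E2|E2]; [|nra].
    exfalso. apply H. now apply injective_projections.
  - apply pow_lt, moebius_den_pos, H.
Qed.

Lemma moebius_log_x_C1 a b c d :
  moebius_det a b c d <> 0%C -> exists dx dy, is_C1 (moebius_log_x a b c d) dx dy.
Proof.
  intros H. pose proof (moebius_den_C1 a b c d) as D.
  pose proof (affine_re_C1 a b) as P1. pose proof (affine_im_C1 a b) as P2.
  pose proof (affine_re_C1 c d) as Q1. pose proof (affine_im_C1 c d) as Q2.
  do 2 eexists. unfold moebius_log_x. C1_solve. intros; apply Rgt_not_eq, moebius_den_pos, H.
Qed.

Lemma moebius_log_y_C1 a b c d :
  moebius_det a b c d <> 0%C -> exists dx dy, is_C1 (moebius_log_y a b c d) dx dy.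
Proof.
  intros H. pose proof (moebius_den_C1 a b c d) as D.
  pose proof (affine_re_C1 a b) as P1. pose proof (affine_im_C1 a b) as P2.
  pose proof (affine_re_C1 c d) as Q1. pose proof (affine_im_C1 c d) as Q2.
  do 2 eexists. unfold moebius_log_y. C1_solve. intros; apply Rgt_not_eq, moebius_den_pos, H.
Qed.

Definition moebius_chart (a b c d : C) (H : moebius_det a b c d <> 0%C) : sphere_chart.
Proof.
  refine (Build_sphere_chart _ _ _ _ _ _
    (fun x y => moebius_rho_pos a b c d x y H) (moebius_rho_C1 a b c d H)
    (moebius_log_x_C1 a b c d H) (moebius_log_y_C1 a b c d H) (moebius_nrm_C1 a b c d H)
    (moebius_nrm_x_C1 a b c d H) (moebius_nrm_y_C1 a b c d H) _ _ _ _ _); intros x y.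
  1-4: moebius_identity H x y.
  apply R3_ext; moebius_identity H x y.
Defined.

(** In the coordinate 1/z the two coefficients of P change places, as do those of Q, and
    P, Q acquire a common factor, which does not change the normal. *)
Lemma moebius_nrm_inverted a b c d :
  moebius_det a b c d <> 0%C -> inverted (moebius_nrm a b c d) (moebius_nrm b a d c).
Proof.
  intros H x y N. assert (D := moebius_den_pos _ _ _ _ x y H).
  assert (ER : forall a b, affine_re b a (inv_re x y) (inv_im x y) =
     (affine_re a b x y * x + affine_im a b x y * y) / (x ^ 2 + y ^ 2)).
  { intros p q. unfold affine_re, affine_im, inv_re, inv_im. field. exact N. }
  assert (EI : forall a b, affine_im b a (inv_re x y) (inv_im x y) =
     (affine_im a b x y * x - affine_re a b x y * y) / (x ^ 2 + y ^ 2)).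
  { intros p q. unfold affine_re, affine_im, inv_re, inv_im. field. exact N. }
  assert (ED : moebius_den b a d c (inv_re x y) (inv_im x y) =
    moebius_den a b c d x y / (x ^ 2 + y ^ 2)).
  { unfold moebius_den. rewrite !ER, !EI. field. exact N. }
  unfold moebius_nrm. rewrite ED, !ER, !EI.
  apply R3_ext; unfold p1, p2, p3; cbn [fst snd]; field; split; lra.
Qed.

Lemma moebius_det_swap a b c d : moebius_det a b c d <> 0%C -> moebius_det b a d c <> 0%C.
Proof.
  intros H E. apply H. unfold moebius_det in *. injection E as E1 E2.
  apply injective_projections; simpl in *; lra.
Qed.

Lemma moebius_chart_inverted a b c d H H' :
  inverted (nrm (moebius_chart a b c d H)) (nrm (moebius_chart b a d c H')).
Proof. exact (moebius_nrm_inverted a b c d H). Qed.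

(** The normals of the two charts correspond under a Lorentz boost along e3 acting on
    the sphere of null directions.  Its conformal factor makes rho' / (k^2 - 1) the metric
    rho / (n3 + k)^2, the one that a bubble inherits from hyperbolic space. *)
Definition lorentz_related (k : R) (S S' : sphere_chart) : Prop :=
  forall x y,
    (p3 (nrm S x y) + k) ^ 2 * rho S' x y = (k ^ 2 - 1) * rho S x y /\
    smul (p3 (nrm S x y) + k) (nrm S' x y) =
    (sqrt (k ^ 2 - 1) * p1 (nrm S x y), sqrt (k ^ 2 - 1) * p2 (nrm S x y),
     k * p3 (nrm S x y) + 1).

Definition real_mult (l : R) (a : C) : C := (l * fst a, l * snd a).

Lemma moebius_det_real_mult l a b c d :
  moebius_det (real_mult l a) (real_mult l b) c d = real_mult l (moebius_det a b c d).
Proof. unfold moebius_det, real_mult. apply injective_projections; simpl; ring. Qed.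

Lemma real_mult_neq_0 l (a : C) : l <> 0 -> a <> 0%C -> real_mult l a <> 0%C.
Proof.
  intros L A H. apply A. unfold real_mult in H. injection H as H1 H2.
  apply injective_projections; simpl; apply (Rmult_eq_reg_l l); lra.
Qed.

Lemma affine_re_real_mult l a b x y : affine_re (real_mult l a) (real_mult l b) x y =
  l * affine_re a b x y.
Proof. unfold affine_re, real_mult; simpl. ring. Qed.

Lemma affine_im_real_mult l a b x y : affine_im (real_mult l a) (real_mult l b) x y =
  l * affine_im a b x y.
Proof. unfold affine_im, real_mult; simpl. ring. Qed.

(** The boost is the dilation by l with l^2 = (k + 1) / (k - 1). *)
Lemma moebius_chart_lorentz k l a b c d H H' :
  1 < k -> 0 < l -> l ^ 2 * (k - 1) = k + 1 ->
  lorentz_related k (moebius_chart a b c d H)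
    (moebius_chart (real_mult l a) (real_mult l b) c d H').
Proof.
  intros Hk Hl El x y.
  assert (Es : sqrt (k ^ 2 - 1) = l * (k - 1)).
  { replace (k ^ 2 - 1) with ((l * (k - 1)) * (l * (k - 1)))
      by (rewrite <- (Rmult_1_r (k^2 - 1)); nra).
    apply sqrt_square. nra. }
  assert (D := moebius_den_pos _ _ _ _ x y H). assert (D' := moebius_den_pos _ _ _ _ x y H').
  assert (Ek : k ^ 2 - 1 = (k - 1) ^ 2 * l ^ 2) by (transitivity ((k - 1) * (k + 1));
    [ring|rewrite <- El; ring]).
  assert (Eu : p3 (moebius_nrm a b c d x y) + k =
    (k - 1) * moebius_den (real_mult l a) (real_mult l b) c d x y / moebius_den a b c d x y).
  { unfold moebius_nrm, p3; cbn [snd]. apply (Rmult_eq_reg_r (moebius_den a b c d x y)); [|lra].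
    field_simplify; [|lra|lra]. unfold moebius_den.
    rewrite !affine_re_real_mult, !affine_im_real_mult.
    transitivity ((k + 1) * (affine_re a b x y ^ 2 + affine_im a b x y ^ 2)
       + (k - 1) * (affine_re c d x y ^ 2 + affine_im c d x y ^ 2)); [ring|]. rewrite <- El. ring. }
  rewrite Es. cbn [moebius_chart nrm rho]. rewrite Eu. unfold moebius_rho.
  rewrite moebius_det_real_mult.
  split.
  - rewrite Ek. change (fst (real_mult l (moebius_det a b c d))) with
      (l * fst (moebius_det a b c d)).
    change (snd (real_mult l (moebius_det a b c d))) with (l * snd (moebius_det a b c d)).
    field. lra.
  - apply R3_ext; unfold smul, moebius_nrm, p1, p2, p3; cbn [fst snd];
      rewrite !affine_re_real_mult, !affine_im_real_mult.
    + field. lra.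
    + field. lra.
    + transitivity (((k - 1) * l ^ 2 * (affine_re a b x y ^ 2 + affine_im a b x y ^ 2)
         - (k - 1) * (affine_re c d x y ^ 2 + affine_im c d x y ^ 2)) / moebius_den a b c d x y).
      * field. lra.
      * rewrite (Rmult_comm (k - 1)), El. unfold moebius_den in *. field. lra.
Qed.

(** * The linearised system in the moving frame *)

(** The linearised system for phi = F at U = q + r n, multiplied by U3 / r = n3 + k and with
    Lap n = - 2 rho n inserted. *)
Definition bubble_system (k : R) (S : sphere_chart) (F : C2_field) : Prop :=
  forall x y,
    let n := nrm S x y in let nx := nrm_x S x y in let ny := nrm_y S x y in
    let fx := fld_x F x y in let fy := fld_y F x y in
    smul (p3 n + k) (vadd (fld_xx F x y) (fld_yy F x y)) =
    comb 2 (comb (p3 nx) fx (p3 ny) fy (- (dot nx fx + dot ny fy)) e3)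
      2 (comb (p3 fx) nx (p3 fy) ny (rho S x y * p3 (fld F x y)) n)
      (2 * k) (comb 1 (cross fx ny) 1 (cross nx fy) 0 n).

Lemma bubble_system_dot k S F x y w :
  bubble_system k S F ->
  let n := nrm S x y in let nx := nrm_x S x y in let ny := nrm_y S x y in
  (p3 n + k) * dot (vadd (fld_xx F x y) (fld_yy F x y)) w =
  2 * (p3 nx * dot (fld_x F x y) w + p3 ny * dot (fld_y F x y) w
       - (dot (fld_x F x y) nx + dot (fld_y F x y) ny) * p3 w
       + p3 (fld_x F x y) * dot nx w + p3 (fld_y F x y) * dot ny w
       + rho S x y * p3 (fld F x y) * dot n w)
  + 2 * k * (dot (fld_x F x y) (cross ny w) + dot (fld_y F x y) (cross w nx)).
Proof.
  intros Sys n nx ny. specialize (Sys x y). cbv zeta in Sys. fold n nx ny in Sys.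
  apply (f_equal (fun v => dot v w)) in Sys.
  rewrite dot_smul, !dot_comb in Sys.
  rewrite triple_rotate, (triple_rotate nx), (dot_comm e3), dot_e3 in Sys.
  rewrite (triple_cycle nx) in Sys.
  rewrite Sys, (dot_comm nx (fld_x F x y)), (dot_comm ny (fld_y F x y)). ring.
Qed.

(** With f = F . n, only f, its gradient and the divergence term
    F_x . n_x + F_y . n_y occur on the right, and the latter also appears in the Laplacian
    of f, with the opposite sign. *)
Lemma bubble_system_normal k S F x y :
  bubble_system k S F ->
  let n := nrm S x y in let nx := nrm_x S x y in let ny := nrm_y S x y in
  (p3 n + k) * dot (vadd (fld_xx F x y) (fld_yy F x y)) n =
  2 * (p3 nx * (dot (fld_x F x y) n + dot (fld F x y) nx) + p3 ny * (dot (fld_y F x y) n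
    + dot (fld F x y) ny))
  + 2 * rho S x y * p3 n * dot (fld F x y) n
  - 2 * (p3 n + k) * (dot (fld_x F x y) nx + dot (fld_y F x y) ny).
Proof.
  intros Sys n nx ny. unfold n, nx, ny.
  rewrite (bubble_system_dot _ _ _ x y (nrm S x y) Sys).
  rewrite cross_y_n, cross_n_x, frame_height, !(dot_comm _ (smul _ _)), !dot_smul.
  rewrite (dot_comm (nrm_x S x y) (nrm S x y)), (dot_comm (nrm_y S x y) (nrm S x y)),
    nrm_dot_x, nrm_dot_y, nrm_unit,
    (dot_comm (nrm_x S x y) (fld_x F x y)), (dot_comm (nrm_y S x y) (fld_y F x y)).
  ring.
Qed.

(** The last term is 2 rho (n3 + k) F_x . n, that is, minus (n3 + k) times what
    F_x . Lap n contributes to the divergence of the Hopf coefficients. *)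
Lemma bubble_system_x k S F x y :
  bubble_system k S F ->
  let n := nrm S x y in let nx := nrm_x S x y in let ny := nrm_y S x y in
  (p3 n + k) * dot (vadd (fld_xx F x y) (fld_yy F x y)) nx =
  2 * (p3 nx * (dot (fld_x F x y) nx - dot (fld_y F x y) ny) + p3 ny * (dot (fld_x F x y) ny
    + dot (fld_y F x y) nx))
  + 2 * rho S x y * (p3 n + k) * dot (fld_x F x y) n.
Proof.
  intros Sys n nx ny. unfold n, nx, ny.
  rewrite (bubble_system_dot _ _ _ x y (nrm_x S x y) Sys).
  rewrite cross_y_x, cross_self, nrm_xx, (dot_comm (nrm_y S x y) (nrm_x S x y)), nrm_xy, nrm_dot_x.
  rewrite (Rmult_comm (p3 (fld_x F x y))), frame_height.
  rewrite !(dot_comm _ (smul _ _)), !dot_smul, (dot_comm (nrm S x y) (fld_x F x y)),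
    (dot_comm (nrm_x S x y) (fld_y F x y)).
  ring.
Qed.

Lemma bubble_system_y k S F x y :
  bubble_system k S F ->
  let n := nrm S x y in let nx := nrm_x S x y in let ny := nrm_y S x y in
  (p3 n + k) * dot (vadd (fld_xx F x y) (fld_yy F x y)) ny =
  2 * (p3 nx * (dot (fld_x F x y) ny + dot (fld_y F x y) nx) - p3 ny * (dot (fld_x F x y) nx
    - dot (fld_y F x y) ny))
  + 2 * rho S x y * (p3 n + k) * dot (fld_y F x y) n.
Proof.
  intros Sys n nx ny. unfold n, nx, ny.
  rewrite (bubble_system_dot _ _ _ x y (nrm_y S x y) Sys).
  rewrite cross_self, cross_y_x, nrm_yy, nrm_xy, nrm_dot_y.
  rewrite (Rmult_comm (p3 (fld_y F x y))), frame_height.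
  rewrite !(dot_comm _ (smul _ _)), !dot_smul, (dot_comm (nrm S x y) (fld_y F x y)),
    (dot_comm (nrm_y S x y) (fld_x F x y)).
  ring.
Qed.

(** * The Hopf differential *)

(** [hopf_re] - i [hopf_im] is, up to the factor 4, the coefficient F_z . n_z of the
    linearised Hopf differential. *)
Definition hopf_re (S : sphere_chart) (F : C2_field) (x y : R) : R :=
  dot (fld_x F x y) (nrm_x S x y) - dot (fld_y F x y) (nrm_y S x y).

Definition hopf_im (S : sphere_chart) (F : C2_field) (x y : R) : R :=
  dot (fld_x F x y) (nrm_y S x y) + dot (fld_y F x y) (nrm_x S x y).

(** To first order, the deformation F keeps the map n conformal. *)
Definition hopf_free (S : sphere_chart) (F : C2_field) : Prop :=
  forall x y, hopf_re S F x y = 0 /\ hopf_im S F x y = 0.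

Lemma hopf_re_C1 S F :
  is_C1 (hopf_re S F)
    (fun x y => dot (fld_xx F x y) (nrm_x S x y) - dot (fld_xy F x y) (nrm_y S x y)
       - rho S x y * dot (fld_x F x y) (nrm S x y)
       + log_x S x y * hopf_re S F x y - log_y S x y * hopf_im S F x y)
    (fun x y => dot (fld_xy F x y) (nrm_x S x y) - dot (fld_yy F x y) (nrm_y S x y)
       + rho S x y * dot (fld_y F x y) (nrm S x y)
       + log_y S x y * hopf_re S F x y + log_x S x y * hopf_im S F x y).
Proof.
  eapply is_C1_eq.
  - apply is_C1_minus.
    + exact (is_C1_dot _ _ _ _ _ _ (fld_x_C1 F) (nrm_x_C1 S)).
    + exact (is_C1_dot _ _ _ _ _ _ (fld_y_C1 F) (nrm_y_C1 S)).
  - intros; unfold hopf_re, hopf_im; rewrite !dot_comb_r. ring.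
  - intros; unfold hopf_re, hopf_im; rewrite !dot_comb_r. ring.
Qed.

Lemma hopf_im_C1 S F :
  is_C1 (hopf_im S F)
    (fun x y => dot (fld_xx F x y) (nrm_y S x y) + dot (fld_xy F x y) (nrm_x S x y)
       - rho S x y * dot (fld_y F x y) (nrm S x y)
       + log_y S x y * hopf_re S F x y + log_x S x y * hopf_im S F x y)
    (fun x y => dot (fld_xy F x y) (nrm_y S x y) + dot (fld_yy F x y) (nrm_x S x y)
       - rho S x y * dot (fld_x F x y) (nrm S x y)
       - log_x S x y * hopf_re S F x y + log_y S x y * hopf_im S F x y).
Proof.
  eapply is_C1_eq.
  - apply is_C1_plus.
    + exact (is_C1_dot _ _ _ _ _ _ (fld_x_C1 F) (nrm_y_C1 S)).
    + exact (is_C1_dot _ _ _ _ _ _ (fld_y_C1 F) (nrm_x_C1 S)).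
  - intros; unfold hopf_re, hopf_im; rewrite !dot_comb_r. ring.
  - intros; unfold hopf_re, hopf_im; rewrite !dot_comb_r. ring.
Qed.

(** The frame equations cancel the derivatives of log(rho) in the divergence and the
    curl of the Hopf coefficients, and the system gives what is left; the weight n3 + k
    accounts for the hyperbolic metric. *)
Lemma hopf_vanishes k S F :
  1 < k -> bubble_system k S F ->
  tends_at_infinity (fun x y => hopf_re S F x y / (p3 (nrm S x y) + k) ^ 2) 0 ->
  tends_at_infinity (fun x y => hopf_im S F x y / (p3 (nrm S x y) + k) ^ 2) 0 ->
  hopf_free S F.
Proof.
  intros Hk Sys T1 T2. destruct (nrm_C1 S) as (_ & _ & N3). unfold hopf_free.
  apply (weighted_liouville _ _ _ _ _ _ _ _ _
    (is_C1_plus _ _ _ _ _ _ N3 (is_C1_const k)) (hopf_re_C1 S F) (hopf_im_C1 S F));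
    [| | |exact T1|exact T2]; intros x y; unfold hopf_re, hopf_im; cbv beta.
  - generalize (nrm_bounds S x y); lra.
  - assert (E := bubble_system_x _ _ _ x y Sys). cbv zeta in E. rewrite dot_vadd in E. lra.
  - assert (E := bubble_system_y _ _ _ x y Sys). cbv zeta in E. rewrite dot_vadd in E. lra.
Qed.

(** A quadratic differential is multiplied by (dw/dz)^2 = w^4, and
    w^2 = m + i l. *)
Lemma hopf_inverted S T F G x y :
  inverted (nrm S) (nrm T) -> inverted (fld F) (fld G) -> x ^ 2 + y ^ 2 <> 0 ->
  let u := inv_re x y in let v := inv_im x y in
  let m := u ^ 2 - v ^ 2 in let l := 2 * u * v in
  hopf_re S F x y = (m ^ 2 - l ^ 2) * hopf_re T G u v + 2 * m * l * hopf_im T G u v /\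
  hopf_im S F x y = (m ^ 2 - l ^ 2) * hopf_im T G u v - 2 * m * l * hopf_re T G u v.
Proof.
  intros IN IF N u v m l.
  destruct (inverted_derivatives_v _ _ _ _ _ _ x y (nrm_C1 S) (nrm_C1 T) IN N) as [N1 N2].
  destruct (inverted_derivatives_v _ _ _ _ _ _ x y (fld_C1 F) (fld_C1 G) IF N) as [P1 P2].
  unfold hopf_re, hopf_im. rewrite N1, N2, P1, P2. fold u v.
  rewrite !dot_comb, !dot_comb_r.
  rewrite !(dot_comm e3). unfold m, l. split; ring.
Qed.

Lemma hopf_free_inverted S T F G :
  inverted (nrm S) (nrm T) -> inverted (fld F) (fld G) -> hopf_free S F -> hopf_free T G.
Proof.
  intros IN IF H.
  assert (P : forall x y, x ^ 2 + y ^ 2 <> 0 ->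
    hopf_re T G x y = 0 /\ hopf_im T G x y = 0).
  { intros x y N.
    destruct (hopf_inverted T S G F x y (inverted_sym _ _ IN) (inverted_sym _ _ IF) N) as [-> ->].
    destruct (H (inv_re x y) (inv_im x y)) as [-> ->]. split; ring. }
  intros x y. destruct (Req_dec (x ^ 2 + y ^ 2) 0) as [E | N]; [|now apply P].
  replace x with 0 by nra. replace y with 0 by nra. split.
  - apply continuity_2d_pt_origin; [|intros; now apply P].
    eapply is_C1_continuity, (hopf_re_C1 T G).
  - apply continuity_2d_pt_origin; [|intros; now apply P].
    eapply is_C1_continuity, (hopf_im_C1 T G).
Qed.

(** The factor w^4 makes the quotients tend to 0 at infinity. *)
Lemma hopf_free_of_system k S T F G :
  1 < k -> inverted (nrm S) (nrm T) -> inverted (fld F) (fld G) ->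
  bubble_system k S F ->
  hopf_free S F.
Proof.
  intros Hk IN IF Sys.
  assert (PX := is_C1_x). assert (PY := is_C1_y).
  pose proof (hopf_re_C1 T G) as A.
  pose proof (hopf_im_C1 T G) as B.
  destruct (nrm_C1 T) as (_ & _ & N3).
  assert (V : forall x y, (p3 (nrm T x y) + k) ^ 2 <> 0).
  { intros x y. apply pow_nonzero. generalize (nrm_bounds T x y). lra. }
  assert (NZ : forall x y, x ^ 2 + y ^ 2 <> 0 ->
    p3 (nrm S x y) = p3 (nrm T (inv_re x y) (inv_im x y)))
    by (intros; now rewrite IN).
  apply (hopf_vanishes k S F Hk Sys).
  - assert (C : exists gx gy, is_C1 (fun u v =>
      (((u ^ 2 - v ^ 2) ^ 2 - (2 * u * v) ^ 2) * hopf_re T G u v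
       + 2 * (u ^ 2 - v ^ 2) * (2 * u * v) * hopf_im T G u v)
      / (p3 (nrm T u v) + k) ^ 2) gx gy) by (do 2 eexists; C1_solve; exact V).
    destruct C as (gx & gy & C).
    eassert (L := inverted_limit _ _ (fun _ _ _ => eq_refl) (is_C1_continuity _ _ _ 0 0 C)).
    cbv beta in L. revert L.
    match goal with |- tends_at_infinity _ ?c -> _ => replace c with 0 end.
    + apply tends_at_infinity_eventually. intros u v N. rewrite (NZ u v N).
      f_equal. symmetry.
      apply (hopf_inverted S T F G u v IN IF N).
    + unfold Rdiv. ring.
  - assert (C : exists gx gy, is_C1 (fun u v =>
      (((u ^ 2 - v ^ 2) ^ 2 - (2 * u * v) ^ 2) * hopf_im T G u v
       - 2 * (u ^ 2 - v ^ 2) * (2 * u * v) * hopf_re T G u v)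
      / (p3 (nrm T u v) + k) ^ 2) gx gy) by (do 2 eexists; C1_solve; exact V).
    destruct C as (gx & gy & C).
    eassert (L := inverted_limit _ _ (fun _ _ _ => eq_refl) (is_C1_continuity _ _ _ 0 0 C)).
    cbv beta in L. revert L.
    match goal with |- tends_at_infinity _ ?c -> _ => replace c with 0 end.
    + apply tends_at_infinity_eventually. intros u v N. rewrite (NZ u v N).
      f_equal. symmetry.
      apply (hopf_inverted S T F G u v IN IF N).
    + unfold Rdiv. ring.
Qed.

(** * Holomorphic vector fields on the sphere *)

Definition cauchy_riemann (ax ay bx b_y : R -> R -> R) : Prop :=
  forall x y, ax x y = b_y x y /\ ay x y = - bx x y.

(** f + i g = a + b z + c z^2. *)
Definition quadratic_field (f g : R -> R -> R) : Prop :=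
  exists a1 a2 b1 b2 c1 c2, forall x y,
    f x y = a1 + (b1 * x - b2 * y) + (c1 * (x ^ 2 - y ^ 2) - c2 * (2 * x * y)) /\
    g x y = a2 + (b1 * y + b2 * x) + (c1 * (2 * x * y) + c2 * (x ^ 2 - y ^ 2)).

Lemma quadratic_field_axpy t f g f' g' :
  quadratic_field f g -> quadratic_field f' g' ->
  quadratic_field (fun x y => f x y - t * f' x y) (fun x y => g x y - t * g' x y).
Proof.
  intros (a1 & a2 & b1 & b2 & c1 & c2 & E) (a1' & a2' & b1' & b2' & c1' & c2' & E').
  exists (a1 - t * a1'), (a2 - t * a2'), (b1 - t * b1'), (b2 - t * b2'), (c1 - t * c1'),
    (c2 - t * c2').
  intros x y. destruct (E x y) as [-> ->], (E' x y) as [-> ->]. split; ring.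
Qed.

(** The complex derivative of X(z) = - z^2 X~(1/z) is - 2 z X~(w) + X~'(w), with
    X~ = p + i q. *)
Lemma holomorphic_field_derivative f fx fy p px py q qx qy x y :
  is_C1 f fx fy -> is_C1 p px py -> is_C1 q qx qy ->
  cauchy_riemann px py qx qy ->
  (forall x y, x ^ 2 + y ^ 2 <> 0 ->
     f x y = - ((x ^ 2 - y ^ 2) * p (inv_re x y) (inv_im x y)
                - 2 * x * y * q (inv_re x y) (inv_im x y))) ->
  x ^ 2 + y ^ 2 <> 0 ->
  let u := inv_re x y in let v := inv_im x y in
  fx x y = - 2 * (x * p u v - y * q u v) + px u v /\
  fy x y = 2 * (x * q u v + y * p u v) + py u v.
Proof.
  intros F P Q CR E N u v. destruct F as (F1 & F2 & _).
  destruct (punctured_near x y N) as [Lx Ly].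
  destruct (CR u v) as [CR1 CR2].
  split.
  - transitivity (Derive (fun t => f t y) x).
    + symmetry. now apply is_derive_unique.
    + apply is_derive_unique.
      apply is_derive_ext_loc with (fun x => - ((x ^ 2 - y ^ 2) * p (inv_re x y) (inv_im x y)
                - 2 * x * y * q (inv_re x y) (inv_im x y))).
      * revert Lx. apply filter_imp. intros t Ht. symmetry. now apply E.
      * pose proof (is_derive_inverted_x _ _ _ x y P N) as DP.
        pose proof (is_derive_inverted_x _ _ _ x y Q N) as DQ.
        cbv zeta in DP, DQ. fold u v in DP, DQ.
        evar_last.
        -- apply (is_derive_opp (fun x => (x ^ 2 - y ^ 2) * p (inv_re x y) (inv_im x y)
                - 2 * x * y * q (inv_re x y) (inv_im x y))).
           apply (is_derive_minus (fun x => (x ^ 2 - y ^ 2) * p (inv_re x y) (inv_im x y))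
             (fun x => 2 * x * y * q (inv_re x y) (inv_im x y))).
           ++ apply (is_derive_mult (fun x => x ^ 2 - y ^ 2) _ x (2 * x));
                [|exact DP|apply Rmult_comm].
              auto_derive; [trivial|ring].
           ++ apply (is_derive_mult (fun x => 2 * x * y) _ x (2 * y)); [|exact DQ|apply Rmult_comm].
              auto_derive; [trivial|ring].
        -- unfold opp, minus, plus, mult, opp; simpl. fold u v.
           replace (qy u v) with (px u v). replace (qx u v) with (- py u v) by lra.
           generalize (p u v) (q u v) (px u v) (py u v). intros.
           unfold u, v, inv_re, inv_im. field. simpl in N; lra.
  - transitivity (Derive (fun t => f x t) y).
    + symmetry. now apply is_derive_unique.
    + apply is_derive_unique.
      apply is_derive_ext_loc with (fun y => - ((x ^ 2 - y ^ 2) * p (inv_re x y) (inv_im x y)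
                - 2 * x * y * q (inv_re x y) (inv_im x y))).
      * revert Ly. apply filter_imp. intros t Ht. symmetry. now apply E.
      * pose proof (is_derive_inverted_y _ _ _ x y P N) as DP.
        pose proof (is_derive_inverted_y _ _ _ x y Q N) as DQ.
        cbv zeta in DP, DQ. fold u v in DP, DQ.
        evar_last.
        -- apply (is_derive_opp (fun y => (x ^ 2 - y ^ 2) * p (inv_re x y) (inv_im x y)
                - 2 * x * y * q (inv_re x y) (inv_im x y))).
           apply (is_derive_minus (fun y => (x ^ 2 - y ^ 2) * p (inv_re x y) (inv_im x y))
             (fun y => 2 * x * y * q (inv_re x y) (inv_im x y))).
           ++ apply (is_derive_mult (fun y => x ^ 2 - y ^ 2) _ y (- 2 * y));
                [|exact DP|apply Rmult_comm].
              auto_derive; [trivial|ring].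
           ++ apply (is_derive_mult (fun y => 2 * x * y) _ y (2 * x)); [|exact DQ|apply Rmult_comm].
              auto_derive; [trivial|ring].
        -- unfold opp, minus, plus, mult, opp; simpl. fold u v.
           replace (qy u v) with (px u v). replace (qx u v) with (- py u v) by lra.
           generalize (p u v) (q u v) (px u v) (py u v). intros.
           unfold u, v, inv_re, inv_im. field. simpl in N; lra.
Qed.

(** With c = - X~(0), the function X'(z) - 2 c z = - 2 (X~(w) - X~(0)) / w + X~'(w) is
    holomorphic of class C^1 and tends to - X~'(0) at infinity, so it is constant. *)
Lemma holomorphic_field_quadratic f fx fy fxx fxy fyy g gx gy gxx gxy gyy p px py q qx qy :
  is_C1 f fx fy -> is_C1 fx fxx fxy -> is_C1 fy fxy fyy ->
  is_C1 g gx gy -> is_C1 gx gxx gxy -> is_C1 gy gxy gyy ->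
  is_C1 p px py -> is_C1 q qx qy ->
  cauchy_riemann fx fy gx gy -> cauchy_riemann px py qx qy ->
  (forall x y, x ^ 2 + y ^ 2 <> 0 ->
     f x y = - ((x ^ 2 - y ^ 2) * p (inv_re x y) (inv_im x y)
                - 2 * x * y * q (inv_re x y) (inv_im x y))) ->
  quadratic_field f g.
Proof.
  intros F FX FY G GX GY P Q CRf CRp E.
  set (c1 := - p 0 0). set (c2 := - q 0 0).
  destruct (inverted_taylor_remainder _ _ _ P) as [P1 P2].
  destruct (inverted_taylor_remainder _ _ _ Q) as [Q1 Q2].
  generalize P. intros (_ & _ & P5 & P6).
  assert (D := fun x y => holomorphic_field_derivative _ _ _ _ _ _ _ _ _ x y F P Q CRp E).
  cbv zeta in D.
  destruct (CRp 0 0) as [CR1 CR2].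
  assert (LX : inverted (fun x y => px (inv_re x y) (inv_im x y)) px)
    by (intros ? ? ?; reflexivity).
  assert (LY : inverted (fun x y => py (inv_re x y) (inv_im x y)) py)
    by (intros ? ? ?; reflexivity).
  apply inverted_limit in LX; [|apply P5]. apply inverted_limit in LY; [|apply P6].
  (* [H] and [K]: with X = f + i g and c = c1 + i c2, the real part of X' - 2 c z
     and minus its imaginary part. *)
  pose proof (is_C1_minus _ _ _ _ _ _ FX
    (is_C1_minus _ _ _ _ _ _ (is_C1_mult _ _ _ _ _ _ (is_C1_const (2 * c1)) is_C1_x)
       (is_C1_mult _ _ _ _ _ _ (is_C1_const (2 * c2)) is_C1_y))) as H.
  pose proof (is_C1_plus _ _ _ _ _ _ FY
    (is_C1_plus _ _ _ _ _ _ (is_C1_mult _ _ _ _ _ _ (is_C1_const (2 * c1)) is_C1_y)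
       (is_C1_mult _ _ _ _ _ _ (is_C1_const (2 * c2)) is_C1_x))) as K.
  cbv beta in H, K.
  assert (FXX : forall x y, fxx x y = - fyy x y).
  { intros x y.
    assert (G1 : is_C1 gy fxx fxy).
    { apply is_C1_ext with (1 := FX); try reflexivity. intros; apply CRf. }
    assert (G2 : is_C1 gx (fun x y => - fxy x y) (fun x y => - fyy x y)).
    { apply is_C1_ext with (1 := is_C1_opp _ _ _ FY); try reflexivity.
      intros u v; cbv beta; destruct (CRf u v); lra. }
    destruct (is_C1_unique _ _ _ _ _ x y GY G1) as [<- _].
    destruct (is_C1_unique _ _ _ _ _ x y GX G2) as [_ <-]. reflexivity. }
  assert (TH : tends_at_infinity
    (fun x y => fx x y - (2 * c1 * x - 2 * c2 * y)) (- px 0 0)).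
  { replace (- px 0 0) with (px 0 0 + -2 * 0 + 2 * 0 + -2 * px 0 0) by ring.
    assert (T := tends_at_infinity_linear _ _ _ (-2) 2 (-2 * px 0 0) _ _ _ LX P1 Q2).
    revert T. apply tends_at_infinity_eventually. intros x y N.
    destruct (D x y N) as [-> _]. rewrite <- CR1. replace (qx 0 0) with (- py 0 0) by lra.
    generalize (p (inv_re x y) (inv_im x y)) (q (inv_re x y) (inv_im x y)).
    generalize (px (inv_re x y) (inv_im x y)). unfold c1, c2, inv_re, inv_im.
    intros. field. lra. }
  assert (TK : tends_at_infinity
    (fun x y => fy x y + (2 * c1 * y + 2 * c2 * x)) (- py 0 0)).
  { replace (- py 0 0) with (py 0 0 + 2 * 0 + 2 * 0 + -2 * py 0 0) by ring.
    assert (T := tends_at_infinity_linear _ _ _ 2 2 (-2 * py 0 0) _ _ _ LY Q1 P2).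
    revert T. apply tends_at_infinity_eventually. intros x y N.
    destruct (D x y N) as [_ ->]. rewrite <- CR1. replace (qx 0 0) with (- py 0 0) by lra.
    generalize (p (inv_re x y) (inv_im x y)) (q (inv_re x y) (inv_im x y)).
    generalize (py (inv_re x y) (inv_im x y)). unfold c1, c2, inv_re, inv_im.
    intros. field. lra. }
  assert (RX : forall x y, fx x y - (2 * c1 * x - 2 * c2 * y) = - px 0 0).
  { apply (cauchy_riemann_liouville _ _ _ _ _ _ _ H (is_C1_opp _ _ _ K)); [| |exact TH];
      intros x y; cbv beta; rewrite ?FXX; ring. }
  assert (RY : forall x y, fy x y + (2 * c1 * y + 2 * c2 * x) = - py 0 0).
  { apply (cauchy_riemann_liouville _ _ _ _ _ _ _ K H); [| |exact TK];
      intros x y; cbv beta; rewrite ?FXX; ring. }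
  exists (f 0 0), (g 0 0), (- px 0 0), (py 0 0), c1, c2.
  assert (PX := is_C1_x). assert (PY := is_C1_y).
  intros x y. split; apply Rminus_diag_uniq.
  - assert (Z := is_C1_zero_gradient (fun x y => f x y - (f 0 0 + (- px 0 0 * x - py 0 0 * y)
      + (c1 * (x ^ 2 - y ^ 2) - c2 * (2 * x * y)))) (fun _ _ => 0) (fun _ _ => 0)).
    cbv beta in Z. rewrite Z; [ring| |reflexivity|reflexivity].
    eapply is_C1_eq; [C1_solve| |]; intros u v; cbv beta.
    + specialize (RX u v). lra.
    + specialize (RY u v). lra.
  - assert (Z := is_C1_zero_gradient (fun x y => g x y - (g 0 0 + (- px 0 0 * y + py 0 0 * x)
      + (c1 * (2 * x * y) + c2 * (x ^ 2 - y ^ 2)))) (fun _ _ => 0) (fun _ _ => 0)).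
    cbv beta in Z. rewrite Z; [ring| |reflexivity|reflexivity].
    eapply is_C1_eq; [C1_solve| |]; intros u v; cbv beta; destruct (CRf u v) as [R1 R2].
    + specialize (RY u v). lra.
    + specialize (RX u v). lra.
Qed.

(** The normal component enters both diagonal derivatives in the same way because the
    sphere is umbilical; what remains of the Cauchy-Riemann operator is the Hopf
    differential. *)
Lemma hopf_free_cauchy_riemann S F :
  hopf_free S F ->
  cauchy_riemann
    (fun x y => tangent_x S (fld_x F) x y - dot (fld F x y) (nrm S x y)
       - log_x S x y * tangent_x S (fld F) x y - log_y S x y * tangent_y S (fld F) x y)
    (fun x y => tangent_x S (fld_y F) x y - log_y S x y * tangent_x S (fld F) x y
       + log_x S x y * tangent_y S (fld F) x y)
    (fun x y => tangent_y S (fld_x F) x y + log_y S x y * tangent_x S (fld F) x y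
       - log_x S x y * tangent_y S (fld F) x y)
    (fun x y => tangent_y S (fld_y F) x y - dot (fld F x y) (nrm S x y)
       - log_x S x y * tangent_x S (fld F) x y - log_y S x y * tangent_y S (fld F) x y).
Proof.
  intros H x y. destruct (H x y) as [H1 H2]. unfold hopf_re in H1. unfold hopf_im in H2.
  assert (E1 : tangent_x S (fld_x F) x y = tangent_y S (fld_y F) x y).
  { unfold tangent_x, tangent_y. f_equal. lra. }
  assert (E2 : tangent_x S (fld_y F) x y = - tangent_y S (fld_x F) x y).
  { unfold tangent_x, tangent_y. rewrite <- Rdiv_opp_l. f_equal. lra. }
  rewrite E1, E2. split; ring.
Qed.

Lemma hopf_free_quadratic S T F G :
  inverted (nrm S) (nrm T) -> inverted (fld F) (fld G) -> hopf_free S F ->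
  quadratic_field (tangent_x S (fld F)) (tangent_y S (fld F)).
Proof.
  intros IN IF H. assert (H' := hopf_free_inverted _ _ _ _ IN IF H).
  pose proof (tangent_x_C1 S _ _ _ (fld_C1 F)) as X.
  pose proof (tangent_y_C1 S _ _ _ (fld_C1 F)) as Y.
  pose proof (tangent_x_C1 S _ _ _ (fld_x_C1 F)) as Xx.
  pose proof (tangent_x_C1 S _ _ _ (fld_y_C1 F)) as Xy.
  pose proof (tangent_y_C1 S _ _ _ (fld_x_C1 F)) as Yx.
  pose proof (tangent_y_C1 S _ _ _ (fld_y_C1 F)) as Yy.
  pose proof (is_C1_dot _ _ _ _ _ _ (fld_C1 F) (nrm_C1 S)) as N.
  destruct (log_x_C1 S) as (lxx & lxy & Lx). destruct (log_y_C1 S) as (lyx & lyy & Ly).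
  assert (Q : forall f fx fy, is_C1 f fx fy -> (exists a b, is_C1 fx a b) ->
    (exists a b, is_C1 fy a b) -> exists a b c, is_C1 fx a b /\ is_C1 fy b c).
  { intros f fx fy Hf (a & b & Hx) (b' & c & Hy). exists a, b, c. split; [exact Hx|].
    apply is_C1_eq with (1 := Hy); [|reflexivity].
    intros u v. now apply (is_C1_schwarz _ _ _ _ _ _ _ _ _ Hf Hx Hy). }
  destruct (Q _ _ _ X) as (xa & xb & xc & X1 & X2); [do 2 eexists; C1_solve .. |].
  destruct (Q _ _ _ Y) as (ya & yb & yc & Y1 & Y2); [do 2 eexists; C1_solve .. |].
  apply (holomorphic_field_quadratic _ _ _ _ _ _ _ _ _ _ _ _ _ _ _ _ _ _ X X1 X2 Y Y1 Y2
    (tangent_x_C1 T _ _ _ (fld_C1 G)) (tangent_y_C1 T _ _ _ (fld_C1 G))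
    (hopf_free_cauchy_riemann S F H) (hopf_free_cauchy_riemann T G H')).
  intros x y Nz. now apply tangent_x_inverted.
Qed.

(** The tangential part of a constant vector is the gradient of a linear function on the
    sphere, a conformal field; a constant deformation has no Hopf differential. *)
Lemma constant_field_quadratic S T e :
  inverted (nrm S) (nrm T) ->
  quadratic_field (tangent_x S (fun _ _ => e)) (tangent_y S (fun _ _ => e)).
Proof.
  intros I. apply (hopf_free_quadratic S T (constant_field e) (constant_field e) I).
  - intros x y _. reflexivity.
  - intros x y. unfold hopf_re, hopf_im, dot, p1, p2, p3; simpl. split; ring.
Qed.

(** * The Jacobi equation of the sphere *)

(** The point whose tangent plane with normal n has support function s.  For
    s = a . n it is the constant a. *)
Definition support_map (S : sphere_chart) (s sx sy : R -> R -> R) (x y : R) : R3 :=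
  comb (s x y) (nrm S x y) (sx x y / rho S x y) (nrm_x S x y) (sy x y / rho S x y) (nrm_y S x y).

(** The derivative of the support map is tangential, and under the Jacobi equation
    symmetric and trace free: these are its two entries in the frame n_x, n_y. *)
Definition shape_1 (S : sphere_chart) (s sx sy sxx : R -> R -> R) (x y : R) : R :=
  s x y + (sxx x y - log_x S x y * sx x y + log_y S x y * sy x y) / rho S x y.

Definition shape_2 (S : sphere_chart) (sx sy sxy : R -> R -> R) (x y : R) : R :=
  (sxy x y - log_x S x y * sy x y - log_y S x y * sx x y) / rho S x y.

Lemma support_map_C1 S s sx sy sxx sxy syy :
  is_C1 s sx sy -> is_C1 sx sxx sxy -> is_C1 sy sxy syy ->
  (forall x y, sxx x y + syy x y = - 2 * rho S x y * s x y) ->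
  is_C1v (support_map S s sx sy)
    (fun x y => comb 0 (nrm S x y) (shape_1 S s sx sy sxx x y) (nrm_x S x y)
                     (shape_2 S sx sy sxy x y) (nrm_y S x y))
    (fun x y => comb 0 (nrm S x y) (shape_2 S sx sy sxy x y) (nrm_x S x y)
                     (- shape_1 S s sx sy sxx x y) (nrm_y S x y)).
Proof.
  intros P X Y J. pose proof (rho_C1 S) as Rh.
  eapply is_C1v_eq.
  - apply is_C1v_comb; [exact P | apply nrm_C1 | | apply nrm_x_C1 | | apply nrm_y_C1].
    + apply (is_C1_div _ _ _ _ _ _ X Rh). apply rho_neq_0.
    + apply (is_C1_div _ _ _ _ _ _ Y Rh). apply rho_neq_0.
  - intros x y. cbv beta. apply R3_ext; unfold shape_1, shape_2, vadd, comb, p1, p2, p3; simpl;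
      field; apply rho_neq_0.
  - intros x y. cbv beta. replace (syy x y) with (- 2 * rho S x y * s x y - sxx x y)
      by (rewrite <- J; ring).
    apply R3_ext; unfold shape_1, shape_2, vadd, comb, p1, p2, p3; simpl;
      field; apply rho_neq_0.
Qed.

Lemma support_map_inverted S T s sx sy t tx ty :
  inverted (nrm S) (nrm T) -> inverted s t ->
  is_C1 s sx sy -> is_C1 t tx ty ->
  inverted (support_map S s sx sy) (support_map T t tx ty).
Proof.
  intros IN I P Q x y N. unfold support_map.
  rewrite (rho_inverted _ _ _ _ IN N), (IN x y N), (I x y N).
  destruct (inverted_derivatives _ _ _ _ _ _ x y P Q I N) as [-> ->].
  destruct (inverted_derivatives_v _ _ _ _ _ _ x y (nrm_C1 S) (nrm_C1 T) IN N) as [-> ->].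
  assert (Z := rho_neq_0 T (inv_re x y) (inv_im x y)). revert Z.
  assert (W : inv_re x y ^ 2 + inv_im x y ^ 2 <> 0).
  { rewrite inv_sqr by exact N. now apply Rinv_neq_0_compat. }
  revert W. generalize (inv_re x y) (inv_im x y). intros u v W Z.
  apply R3_ext; unfold comb, p1, p2, p3; simpl; field; split; try exact Z; simpl in W; lra.
Qed.

Lemma support_map_continuous S s sx sy x y :
  is_C1 s sx sy ->
  continuity_2d_pt (fun x y => p1 (support_map S s sx sy x y)) x y /\
  continuity_2d_pt (fun x y => p2 (support_map S s sx sy x y)) x y /\
  continuity_2d_pt (fun x y => p3 (support_map S s sx sy x y)) x y.
Proof.
  intros P. assert (Cs := is_C1_continuity _ _ _ x y P).
  destruct P as (_ & _ & Cx & Cy).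
  assert (Cr := is_C1_continuity _ _ _ x y (rho_C1 S)).
  destruct (nrm_C1 S) as (N1 & N2 & N3). destruct (nrm_x_C1 S) as (X1 & X2 & X3).
  destruct (nrm_y_C1 S) as (Y1 & Y2 & Y3).
  split; [|split]; unfold support_map, comb, Rdiv, p1 at 1, p2 at 1, p3 at 1; cbn [fst snd];
    repeat first [apply continuity_2d_pt_plus | apply continuity_2d_pt_mult];
    auto using rho_neq_0, continuity_2d_pt_inv; eapply is_C1_continuity; eassumption.
Qed.

(** The support map Y satisfies Y_x = - n /\ Y_y and Y_y = n /\ Y_x.  Since
    n /\ dY = d(n /\ Y) - dn /\ Y, and dn /\ Y is a closed form of class C^1 by the
    symmetry and tracelessness of dY, the Liouville theorem applies to Y and gives
    Y = a, whence s = Y . n = a . n. *)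
Lemma jacobi_linear S T s sx sy sxx sxy syy t tx ty :
  inverted (nrm S) (nrm T) -> inverted s t ->
  is_C1 s sx sy -> is_C1 sx sxx sxy -> is_C1 sy sxy syy -> is_C1 t tx ty ->
  (forall x y, sxx x y + syy x y = - 2 * rho S x y * s x y) ->
  exists a, forall x y, s x y = dot a (nrm S x y).
Proof.
  intros IN I P X Y Q J.
  pose proof (support_map_C1 S _ _ _ _ _ _ P X Y J) as H.
  pose proof (is_C1v_cross _ _ _ _ _ _ (nrm_C1 S) H) as K.
  pose proof (is_C1v_cross _ _ _ _ _ _ (nrm_x_C1 S) H) as A.
  pose proof (is_C1v_cross _ _ _ _ _ _ (nrm_y_C1 S) H) as B.
  set (l := support_map T t tx ty 0 0).
  pose proof (support_map_inverted S T _ _ _ _ _ _ IN I P Q) as IY.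
  destruct (support_map_continuous T t tx ty 0 0 Q) as (C1 & C2 & C3).
  exists l. intros x y.
  assert (E : support_map S s sx sy x y = l).
  { revert x y.
    apply (harmonic_liouville_v _ _ _ _ _ _ _ _ _ _ _ _ l H (is_C1v_neg _ _ _ K) A B).
    - intros x y. cbv beta. rewrite cross_comb, cross_n_x, cross_n_y.
      generalize (cross (nrm_y S x y) (support_map S s sx sy x y)). R3_ring.
    - intros x y. cbv beta. rewrite cross_comb, cross_n_x, cross_n_y.
      generalize (cross (nrm_x S x y) (support_map S s sx sy x y)). R3_ring.
    - intros x y. cbv beta.
      generalize (support_map S s sx sy x y). R3_ring.
    - refine (inverted_limit (fun x y => p1 (support_map S s sx sy x y)) _ _ C1).
      intros x y N. now rewrite IY.
    - refine (inverted_limit (fun x y => p2 (support_map S s sx sy x y)) _ _ C2).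
      intros x y N. now rewrite IY.
    - refine (inverted_limit (fun x y => p3 (support_map S s sx sy x y)) _ _ C3).
      intros x y N. now rewrite IY. }
  rewrite <- E. unfold support_map.
  rewrite dot_comb, nrm_unit, !(dot_comm _ (nrm S x y)), nrm_dot_x, nrm_dot_y. ring.
Qed.

(** * The normal part of a solution *)

Lemma normal_component_C2 S F :
  let fx x y := dot (fld_x F x y) (nrm S x y) + dot (fld F x y) (nrm_x S x y) in
  let fy x y := dot (fld_y F x y) (nrm S x y) + dot (fld F x y) (nrm_y S x y) in
  exists fxx fxy fyy,
  is_C1 (fun x y => dot (fld F x y) (nrm S x y)) fx fy /\
  is_C1 fx fxx fxy /\ is_C1 fy fxy fyy /\
  forall x y, fxx x y + fyy x y =
    dot (fld_xx F x y) (nrm S x y) + dot (fld_yy F x y) (nrm S x y)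
    + 2 * (dot (fld_x F x y) (nrm_x S x y) + dot (fld_y F x y) (nrm_y S x y))
    - 2 * rho S x y * dot (fld F x y) (nrm S x y).
Proof.
  intros fx fy.
  pose proof (is_C1_plus _ _ _ _ _ _
    (is_C1_dot _ _ _ _ _ _ (fld_x_C1 F) (nrm_C1 S))
    (is_C1_dot _ _ _ _ _ _ (fld_C1 F) (nrm_x_C1 S))) as FX.
  pose proof (is_C1_plus _ _ _ _ _ _
    (is_C1_dot _ _ _ _ _ _ (fld_y_C1 F) (nrm_C1 S))
    (is_C1_dot _ _ _ _ _ _ (fld_C1 F) (nrm_y_C1 S))) as FY.
  do 3 eexists. split; [|split; [|split]].
  - exact (is_C1_dot _ _ _ _ _ _ (fld_C1 F) (nrm_C1 S)).
  - exact FX.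
  - apply is_C1_eq with (1 := FY); intros x y; cbv beta; [ring|reflexivity].
  - intros x y. cbv beta. rewrite !dot_comb_r. ring.
Qed.

(** For f = F . n the system reads
    (n3 + k) Lap f = 2 grad n3 . grad f - 2 k rho f, which is the Jacobi equation for
    f / (n3 + k) in the metric of the second chart. *)
Lemma bubble_normal_component k S S' T T' F G :
  1 < k -> lorentz_related k S S' ->
  inverted (nrm S) (nrm T) -> inverted (nrm S') (nrm T') -> inverted (fld F) (fld G) ->
  bubble_system k S F ->
  exists a1 a2 a3, forall x y,
    dot (fld F x y) (nrm S x y) =
    a1 * p1 (nrm S x y) + a2 * p2 (nrm S x y) + a3 * (k * p3 (nrm S x y) + 1).
Proof.
  intros Hk Dil IN IN' IF Sys.
  assert (U : forall (S : sphere_chart) x y, p3 (nrm S x y) + k <> 0)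
    by (intros S0 x y; generalize (nrm_bounds S0 x y); lra).
  destruct (normal_component_C2 S F) as (fxx & fxy & fyy & H & HX & HY & Lap).
  destruct (nrm_C1 S) as (_ & _ & N3). destruct (nrm_x_C1 S) as (_ & _ & NX3).
  destruct (nrm_y_C1 S) as (_ & _ & NY3).
  assert (N3k : is_C1 (fun x y => p3 (nrm S x y) + k)
     (fun x y => p3 (nrm_x S x y)) (fun x y => p3 (nrm_y S x y))).
  { eapply is_C1_eq; [C1_solve| |]; intros; cbv beta; ring. }
  destruct (is_C1_quotient_C2 _ _ _ _ _ _ _ _ _ _ _ _ H HX HY N3k NX3 NY3 (U S))
    as (P & PX & PY).
  pose proof (is_C1_dot _ _ _ _ _ _ (fld_C1 G) (nrm_C1 T)) as HT.
  destruct (nrm_C1 T) as (_ & _ & M3).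
  pose proof (is_C1_div _ _ _ _ _ _ HT (is_C1_plus _ _ _ _ _ _ M3 (is_C1_const k)) (U T)) as Q.
  edestruct (fun I J => jacobi_linear S' T' _ _ _ _ _ _ _ _ _ IN' I P PX PY Q J) as [a Ha].
  - intros x y N. cbv beta. now rewrite (IN x y N), (IF x y N).
  - intros x y. cbv beta.
    assert (E := bubble_system_normal _ _ _ x y Sys). cbv zeta in E.
    rewrite dot_vadd in E.
    assert (L := Lap x y).
    assert (Hh := frame_height S x y e3).
    rewrite !(dot_comm e3), !dot_e3 in Hh. change (p3 e3) with 1 in Hh.
    destruct (Dil x y) as [R' _].
    assert (Ux := U S x y).
    replace (rho S' x y) with ((k ^ 2 - 1) * rho S x y / (p3 (nrm S x y) + k) ^ 2)
      by (rewrite <- R'; field; exact Ux).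
    rewrite !p3_comb. revert E L Hh Ux.
    generalize (dot (fld_x F x y) (nrm S x y) + dot (fld F x y) (nrm_x S x y)).
    generalize (dot (fld_y F x y) (nrm S x y) + dot (fld F x y) (nrm_y S x y)).
    intros fy fx E L Hh Ux.
    assert (E' : (p3 (nrm S x y) + k) * (fxx x y + fyy x y) =
      2 * (p3 (nrm_x S x y) * fx + p3 (nrm_y S x y) * fy)
      - 2 * k * rho S x y * dot (fld F x y) (nrm S x y)) by (rewrite L; lra).
    assert (Hg : p3 (nrm_x S x y) ^ 2 + p3 (nrm_y S x y) ^ 2 =
      rho S x y * (1 - p3 (nrm S x y) ^ 2)) by lra.
    clear E L Hh.
    transitivity (((p3 (nrm S x y) + k) * ((p3 (nrm S x y) + k) * (fxx x y + fyy x y)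
        - 2 * (p3 (nrm_x S x y) * fx + p3 (nrm_y S x y) * fy)
        + 2 * rho S x y * p3 (nrm S x y) * dot (fld F x y) (nrm S x y))
      + 2 * dot (fld F x y) (nrm S x y) * (p3 (nrm_x S x y) ^ 2 + p3 (nrm_y S x y) ^ 2))
      / (p3 (nrm S x y) + k) ^ 3).
    + field. exact Ux.
    + rewrite E', Hg. field. exact Ux.
  - exists (sqrt (k ^ 2 - 1) * p1 a), (sqrt (k ^ 2 - 1) * p2 a), (p3 a). intros x y.
    destruct (Dil x y) as [_ V].
    transitivity (dot (fld F x y) (nrm S x y) / (p3 (nrm S x y) + k) * (p3 (nrm S x y) + k)).
    + field. apply U.
    + rewrite Ha, Rmult_comm, dot_comm, <- dot_smul, V.
      unfold dot, p1, p2, p3; simpl. ring.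
Qed.

(** * Bubbles and the linearised system in coordinates *)

Lemma C2_derivatives (f : R -> R -> R) :
  (forall x y, ex_diff_n f 2 x y) ->
  is_C1 f (partial_derive 1 0 f) (partial_derive 0 1 f) /\
  is_C1 (partial_derive 1 0 f) (partial_derive 2 0 f) (partial_derive 1 1 f) /\
  is_C1 (partial_derive 0 1 f) (partial_derive 1 1 f) (partial_derive 0 2 f).
Proof.
  intros H.
  assert (F : is_C1 f (partial_derive 1 0 f) (partial_derive 0 1 f)).
  { split; [|split; [|split]]; intros x y; destruct (H x y) as (_ & H1 & H2 & H3 & H4).
    - exact (Derive_correct _ _ H1).
    - exact (Derive_correct _ _ H2).
    - apply H3.
    - apply H4. }
  assert (FX : is_C1 (partial_derive 1 0 f) (partial_derive 2 0 f)
     (fun x y => Derive (fun t => partial_derive 1 0 f x t) y)).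
  { split; [|split; [|split]]; intros x y;
      destruct (H x y) as (_ & _ & _ & (_ & H1 & H2 & H3 & H4) & _).
    - exact (Derive_correct _ _ H1).
    - exact (Derive_correct _ _ H2).
    - apply H3.
    - apply H4. }
  assert (FY : is_C1 (partial_derive 0 1 f) (partial_derive 1 1 f) (partial_derive 0 2 f)).
  { split; [|split; [|split]]; intros x y;
      destruct (H x y) as (_ & _ & _ & _ & (_ & H1 & H2 & H3 & H4)).
    - exact (Derive_correct _ _ H1).
    - exact (Derive_correct _ _ H2).
    - apply H3.
    - apply H4. }
  split; [exact F|]. split; [|exact FY].
  apply is_C1_eq with (1 := FX); [reflexivity|].
  intros x y. symmetry. exact (is_C1_schwarz _ _ _ _ _ _ _ x y F FX FY).
Qed.

Definition field_of_plane (u : C -> R3) (H : C2_plane u) : C2_field.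
Proof.
  pose proof (C2_derivatives (curried p1 u) (fun x y => proj1 (H x y))) as F1.
  pose proof (C2_derivatives (curried p2 u) (fun x y => proj1 (proj2 (H x y)))) as F2.
  pose proof (C2_derivatives (curried p3 u) (fun x y => proj2 (proj2 (H x y)))) as F3.
  refine (Build_C2_field (fun x y => u (x, y)) (fun x y => Defs.Dx u (x, y))
    (fun x y => Dy u (x, y)) (fun x y => partial3 2 0 u (x, y))
    (fun x y => partial3 1 1 u (x, y)) (fun x y => partial3 0 2 u (x, y)) _ _ _).
  - exact (conj (proj1 F1) (conj (proj1 F2) (proj1 F3))).
  - exact (conj (proj1 (proj2 F1)) (conj (proj1 (proj2 F2)) (proj1 (proj2 F3)))).
  - exact (conj (proj2 (proj2 F1)) (conj (proj2 (proj2 F2)) (proj2 (proj2 F3)))).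
Defined.

Lemma partial3_of_C1v (u : C -> R3) ux uy uxx uxy uyx uyy x y :
  is_C1v (fun x y => u (x, y)) ux uy -> is_C1v ux uxx uxy -> is_C1v uy uyx uyy ->
  Defs.Dx u (x, y) = ux x y /\ Dy u (x, y) = uy x y /\
  partial3 2 0 u (x, y) = uxx x y /\ partial3 0 2 u (x, y) = uyy x y.
Proof.
  assert (K : forall f fx fy fxx fxy fyx fyy, is_C1 f fx fy -> is_C1 fx fxx fxy ->
    is_C1 fy fyx fyy ->
    partial_derive 1 0 f x y = fx x y /\ partial_derive 0 1 f x y = fy x y /\
    partial_derive 2 0 f x y = fxx x y /\ partial_derive 0 2 f x y = fyy x y).
  { intros f fx fy fxx fxy fyx fyy (F1 & F2 & _) (X1 & _) (_ & Y2 & _).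
    split; [|split; [|split]].
    - apply is_derive_unique, F1.
    - apply is_derive_unique, F2.
    - transitivity (Derive (fun t => fx t y) x).
      + apply Derive_ext. intros t. apply is_derive_unique, F1.
      + apply is_derive_unique, X1.
    - transitivity (Derive (fun t => fy x t) y).
      + apply Derive_ext. intros t. apply is_derive_unique, F2.
      + apply is_derive_unique, Y2. }
  intros (F1 & F2 & F3) (X1 & X2 & X3) (Y1 & Y2 & Y3).
  destruct (K _ _ _ _ _ _ _ F1 X1 Y1) as (A1 & A2 & A3 & A4).
  destruct (K _ _ _ _ _ _ _ F2 X2 Y2) as (B1 & B2 & B3 & B4).
  destruct (K _ _ _ _ _ _ _ F3 X3 Y3) as (C1 & C2 & C3 & C4).
  split; [|split; [|split]]; apply R3_ext; assumption.
Qed.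

Lemma omega_moebius a b c d x y :
  moebius_det a b c d <> 0%C -> omega (moebius a b c d (Some (x, y))) = moebius_nrm a b c d x y.
Proof.
  intros H. assert (D := moebius_den_pos _ _ _ _ x y H).
  assert (EP : (a * (x, y) + b)%C = (affine_re a b x y, affine_im a b x y)).
  { unfold affine_re, affine_im. apply injective_projections; simpl; ring. }
  assert (EQ : (c * (x, y) + d)%C = (affine_re c d x y, affine_im c d x y)).
  { unfold affine_re, affine_im. apply injective_projections; simpl; ring. }
  unfold moebius. rewrite EP, EQ. unfold moebius_nrm, moebius_den in *.
  destruct (Ceq_dec _ _) as [E | E].
  - injection E as E1 E2. rewrite E1, E2 in *.
    simpl. unfold e3. apply R3_ext; unfold p1, p2, p3; cbn [fst snd]; field; lra.
  - revert D E. generalize (affine_re a b x y) (affine_im a b x y).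
    generalize (affine_re c d x y) (affine_im c d x y).
    intros Q1 Q2 P1 P2 D E.
    assert (Q : Q1 ^ 2 + Q2 ^ 2 <> 0).
    { intros Z. apply E. apply injective_projections; simpl; nra. }
    unfold omega, mu. apply R3_ext; unfold p1, p2, p3; cbn [fst snd Cdiv Cmult Cinv]; field;
     repeat split; try lra; nra.
Qed.

Lemma is_C1v_scaled_translate (u : C -> R3) r q v vx vy :
  is_C1v v vx vy -> (forall x y, u (x, y) = vadd (smul r (v x y)) q) ->
  is_C1v (fun x y => u (x, y)) (fun x y => smul r (vx x y)) (fun x y => smul r (vy x y)).
Proof.
  intros (V1 & V2 & V3) E.
  assert (K : forall f fx fy c g, is_C1 f fx fy -> (forall x y, g x y = r * f x y + c) ->
    is_C1 g (fun x y => r * fx x y) (fun x y => r * fy x y)).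
  { intros f fx fy c g F Eg.
    apply is_C1_ext with
      (1 := is_C1_plus _ _ _ _ _ _ (is_C1_mult _ _ _ _ _ _ (is_C1_const r) F) (is_C1_const c));
      intros x y; rewrite ?Eg; ring. }
  split; [|split].
  - apply (K _ _ _ (p1 q) _ V1). intros x y. now rewrite E.
  - apply (K _ _ _ (p2 q) _ V2). intros x y. now rewrite E.
  - apply (K _ _ _ (p3 q) _ V3). intros x y. now rewrite E.
Qed.

Lemma bubble_derivatives (S : sphere_chart) (U : C -> R3) r q x y :
  (forall x y, U (x, y) = vadd (smul r (nrm S x y)) q) ->
  Defs.Dx U (x, y) = smul r (nrm_x S x y) /\ Dy U (x, y) = smul r (nrm_y S x y) /\
  vadd (partial3 2 0 U (x, y)) (partial3 0 2 U (x, y)) = smul (- 2 * r * rho S x y) (nrm S x y).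
Proof.
  intros E.
  pose proof (is_C1v_scaled_translate U r q _ _ _ (nrm_C1 S) E) as F.
  pose proof (is_C1v_scaled_translate (fun z => smul r (nrm_x S (fst z) (snd z))) r (0, 0, 0) _ _ _
    (nrm_x_C1 S)) as FX.
  assert (K : forall v vx vy, is_C1v v vx vy ->
    is_C1v (fun x y => smul r (v x y)) (fun x y => smul r (vx x y)) (fun x y => smul r (vy x y))).
  { intros v vx vy V.
    apply (is_C1v_scaled_translate (fun z => smul r (v (fst z) (snd z))) r (0, 0, 0) _ _ _ V).
    intros; cbn [fst snd]. apply R3_ext; unfold vadd, smul, p1, p2, p3; simpl; ring. }
  destruct (partial3_of_C1v U _ _ _ _ _ _ x y F (K _ _ _ (nrm_x_C1 S)) (K _ _ _ (nrm_y_C1 S)))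
    as (-> & -> & -> & ->).
  split; [reflexivity|]. split; [reflexivity|].
  apply R3_ext; unfold vadd, smul, comb, p1, p2, p3; simpl; ring.
Qed.

Ltac bubble_component E :=
  unfold plus, opp, scal, mult in E; simpl in E; unfold mult in E; simpl in E;
  match type of E with ?l + - ?g = _ => match goal with |- ?u * _ = _ =>
    transitivity (u * (l + - g) + u * g); [ring | rewrite E; field; lra] end end.

Lemma bubble_system_of_linearized k S U r q phi (H : C2_plane phi) :
  1 < k -> 0 < r -> p3 q = r * k ->
  (forall x y, U (x, y) = vadd (smul r (nrm S x y)) q) ->
  linearized_system k U phi ->
  bubble_system k S (field_of_plane phi H).
Proof.
  intros Hk Hr Hq E Sys x y. cbv zeta. specialize (Sys (x, y)).
  destruct (bubble_derivatives S U r q x y E) as (EX & EY & EL).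
  assert (EU : p3 (U (x, y)) = r * (p3 (nrm S x y) + k)).
  { rewrite E. unfold vadd, smul, p3 in *; simpl. rewrite Hq. ring. }
  assert (Pu : p3 (nrm S x y) + k <> 0) by (generalize (nrm_bounds S x y); lra).
  unfold dG, grad_dot_comp, grad_dot in Sys. cbv zeta in Sys.
  change (Laplacian U (x, y)) with (vadd (partial3 2 0 U (x, y)) (partial3 0 2 U (x, y))) in Sys.
  change (Laplacian phi (x, y)) with
    (vadd (partial3 2 0 phi (x, y)) (partial3 0 2 phi (x, y))) in Sys.
  rewrite EX, EY, EL, EU in Sys.
  cbn [field_of_plane fld fld_x fld_y fld_xx fld_yy].
  revert Sys.
  generalize (Defs.Dx phi (x, y)) (Dy phi (x, y))
    (partial3 2 0 phi (x, y)) (partial3 0 2 phi (x, y))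
    (phi (x, y)).
  intros [[a1 a2] a3] [[b1 b2] b3] [[c1 c2] c3] [[d1 d2] d3] [[f1 f2] f3].
  revert Pu. generalize (nrm S x y) (nrm_x S x y) (nrm_y S x y) (rho S x y).
  intros [[n1 n2] n3] [[x1 x2] x3] [[y1 y2] y3] rh Pu Sys.
  unfold minus, plus, scal, opp in Sys; simpl in Sys.
  unfold minus, plus, scal, opp, mult, vadd, smul, dot, cross, p1, p2, p3 in Sys; simpl in Sys.
  unfold p3 in Pu; simpl in Pu.
  injection Sys as S1 S2 S3.
  apply R3_ext; unfold comb, vadd, smul, cross, dot, e3, p1, p2, p3; simpl.
  - bubble_component S1.
  - bubble_component S2.
  - bubble_component S3.
Qed.

(** * Nondegeneracy *)

Lemma tangent_space_intro S U r q phi al1 al2 al3 f g :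
  r <> 0 -> (forall x y, U (x, y) = vadd (smul r (nrm S x y)) q) ->
  quadratic_field f g ->
  (forall x y, phi (x, y) =
     vadd (comb (f x y) (nrm_x S x y) (g x y) (nrm_y S x y) al3 (U (x, y))) (al1, al2, 0)) ->
  tangent_space U phi.
Proof.
  intros Hr EU (a1 & a2 & b1 & b2 & c1 & c2 & E) EP.
  unfold tangent_space. cbn [map app real_span].
  exists al1, al2, al3, (a1 / r), (b1 / r), (c1 / r), (a2 / r), (b2 / r), (c2 / r).
  intros [x y]. unfold along.
  destruct (bubble_derivatives S U r q x y EU) as (-> & -> & _).
  rewrite EP. destruct (E x y) as [-> ->].
  generalize (U (x, y)) (nrm_x S x y) (nrm_y S x y).
  intros [[n1 n2] n3] [[x1 x2] x3] [[y1 y2] y3].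
  unfold minus, plus, scal, opp, mult, zero, vadd, comb, smul, e1, e2, p1, p2, p3; simpl.
  unfold minus, plus, scal, opp, mult, zero; simpl.
  apply R3_ext; unfold p1, p2, p3; simpl;
    do 3 (unfold plus, scal, opp, mult, zero; simpl); field; exact Hr.
Qed.

(** Each n_i n is e_i minus its tangential part, and n + k e3 is (U - q1 e1 - q2 e2) / r. *)
Lemma normal_field_rewriting k r q1 q2 n1 n2 n3 X Y X1 Y1 X2 Y2 X3 Y3 n nx ny :
  r <> 0 ->
  e1 = comb (dot e1 n) n X1 nx Y1 ny -> e2 = comb (dot e2 n) n X2 nx Y2 ny ->
  e3 = comb (dot e3 n) n X3 nx Y3 ny ->
  comb (n1 * p1 n + n2 * p2 n + n3 * (k * p3 n + 1)) n X nx Y ny =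
  vadd (comb (X - n1 * X1 - n2 * X2 - k * n3 * X3) nx (Y - n1 * Y1 - n2 * Y2 - k * n3 * Y3) ny
    (n3 / r) (vadd (smul r n) (q1, q2, r * k))) (n1 - n3 * q1 / r, n2 - n3 * q2 / r, 0).
Proof.
  intros Hr. destruct (dot_coordinates n) as (-> & -> & ->).
  destruct n as [[w1 w2] w3], nx as [[x1 x2] x3], ny as [[y1 y2] y3].
  unfold comb, vadd, smul, e1, e2, e3, p1, p2, p3; simpl. intros D1 D2 D3.
  injection D1 as A1 A2 A3. injection D2 as B1 B2 B3. injection D3 as C1 C2 C3.
  apply R3_ext; unfold p1, p2, p3; simpl; apply Rminus_diag_uniq.
  - transitivity (n1 * (w1 * w1 + X1 * x1 + Y1 * y1 - 1) + n2 * (w2 * w1 + X2 * x1 + Y2 * y1)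
      + k * n3 * (w3 * w1 + X3 * x1 + Y3 * y1)).
    + field. exact Hr.
    + rewrite <- A1, <- B1, <- C1. ring.
  - transitivity (n1 * (w1 * w2 + X1 * x2 + Y1 * y2) + n2 * (w2 * w2 + X2 * x2 + Y2 * y2 - 1)
      + k * n3 * (w3 * w2 + X3 * x2 + Y3 * y2)).
    + field. exact Hr.
    + rewrite <- A2, <- B2, <- C2. ring.
  - transitivity (n1 * (w1 * w3 + X1 * x3 + Y1 * y3) + n2 * (w2 * w3 + X2 * x3 + Y2 * y3)
      + k * n3 * (w3 * w3 + X3 * x3 + Y3 * y3 - 1)).
    + field. exact Hr.
    + rewrite <- A3, <- B3, <- C3. ring.
Qed.

Theorem theorem1p1 (k : R) (hk : 1 < k)
    (U : C -> R3) (hU : Z_manifold k U)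
    (phi : C -> R3) (hphi : C2_sphere phi)
    (hsys : linearized_system k U phi) :
  tangent_space U phi.
Proof.
  destruct hU as (q & g & Hq & (a & b & c & d & Hdet & Hg) & HU).
  destruct hphi as (Hphi & v & Hv & Hvphi).
  change (moebius_det a b c d <> 0%C) in Hdet.
  assert (Hs : 0 < k ^ 2 - 1) by nra.
  set (r := p3 q * r_ k).
  assert (Hr : 0 < r).
  { unfold r, r_. apply Rmult_lt_0_compat; [exact Hq|].
    apply Rdiv_lt_0_compat; [lra|]. now apply sqrt_lt_R0. }
  set (S := moebius_chart a b c d Hdet).
  set (T := moebius_chart b a d c (moebius_det_swap a b c d Hdet)).
  set (l := sqrt ((k + 1) / (k - 1))).
  assert (Hl : 0 < l) by (apply sqrt_lt_R0, Rdiv_lt_0_compat; lra).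
  assert (El : l ^ 2 * (k - 1) = k + 1).
  { unfold l. rewrite pow2_sqrt; [field; lra|]. apply Rlt_le, Rdiv_lt_0_compat; lra. }
  assert (Hdet' : moebius_det (real_mult l a) (real_mult l b) c d <> 0%C).
  { rewrite moebius_det_real_mult. apply real_mult_neq_0; [lra|exact Hdet]. }
  set (S' := moebius_chart (real_mult l a) (real_mult l b) c d Hdet').
  set (T' := moebius_chart (real_mult l b) (real_mult l a) d c (moebius_det_swap _ _ _ _ Hdet')).
  assert (IN : inverted (nrm S) (nrm T)) by apply moebius_chart_inverted.
  assert (IN' : inverted (nrm S') (nrm T')) by apply moebius_chart_inverted.
  assert (Dil : lorentz_related k S S') by now apply moebius_chart_lorentz.
  assert (EU : forall x y, U (x, y) = vadd (smul r (nrm S x y)) (p1 q, p2 q, r * k)).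
  { intros x y. rewrite HU, Hg. unfold Usf_at, Usf.
    rewrite omega_moebius by exact Hdet. change (nrm S x y) with (moebius_nrm a b c d x y).
    generalize (moebius_nrm a b c d x y). unfold r. generalize (r_ k). intros s [[n1 n2] n3].
    destruct q as [[q1 q2] q3].
    unfold plus, scal, mult, vadd, smul, e1, e2, e3, p1, p2, p3; simpl.
    unfold plus, scal, mult; simpl. unfold mult; simpl.
    apply R3_ext; unfold p1, p2, p3; simpl;
      do 3 (unfold plus, scal, mult; simpl); ring. }
  set (F := field_of_plane phi Hphi). set (G := field_of_plane v Hv).
  assert (IF : inverted (fld F) (fld G)).
  { apply inverted_sym. intros x y N. cbn [F G field_of_plane fld].
    rewrite Hvphi; [reflexivity|]. intros E. apply N. injection E as -> ->. ring. }
  assert (Sys := bubble_system_of_linearized k S U r (p1 q, p2 q, r * k) phi Hphi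
    hk Hr eq_refl EU hsys).
  fold F in Sys.
  assert (HF := hopf_free_of_system k S T F G hk IN IF Sys).
  destruct (bubble_normal_component k S S' T T' F G hk Dil IN IN' IF Sys) as (n1 & n2 & n3 & Hn).
  assert (QF : quadratic_field (tangent_x S (fld F)) (tangent_y S (fld F)))
    by exact (hopf_free_quadratic S T F G IN IF HF).
  assert (Q := quadratic_field_axpy (k * n3) _ _ _ _
    (quadratic_field_axpy n2 _ _ _ _
      (quadratic_field_axpy n1 _ _ _ _ QF (constant_field_quadratic S T e1 IN))
      (constant_field_quadratic S T e2 IN))
    (constant_field_quadratic S T e3 IN)).
  apply (tangent_space_intro S U r (p1 q, p2 q, r * k) phi
    (n1 - n3 * p1 q / r) (n2 - n3 * p2 q / r) (n3 / r) _ _ ltac:(lra) EU Q).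
  intros x y. cbv beta.
  assert (D := tangential_decomposition S (fld F) x y). rewrite Hn in D.
  change (fld F x y) with (phi (x, y)) in D. rewrite D, EU.
  apply normal_field_rewriting; [lra| | |].
  - exact (tangential_decomposition S (fun _ _ => e1) x y).
  - exact (tangential_decomposition S (fun _ _ => e2) x y).
  - exact (tangential_decomposition S (fun _ _ => e3) x y).
Qed.
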